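(* Let $\Theta=(k_1,\cdots,k_n)^t$ be an $n\times 1$ matrix inner function. Then there exists a $1\times n$ matrix function $\Phi$ on $\mathbb T$ such that $\Theta H^2=\ker H_\Phi$.
   Context: $\mathbb T$ is the unit circle, $H^p$ the Hardy spaces, $H^2_{\mathbb C^n}$ column vectors of $n$ functions in $H^2$. An $n\times1$ matrix function $\Theta=(k_1,\dots,k_n)^t$ with $k_i\in H^\infty$ is inner if $|k_1|^2+\cdots+|k_n|^2=1$ a.e. on $\mathbb T$. For a $1\times n$ measurable matrix function $\Phi=[\phi_1,\dots,\phi_n]$ on $\mathbb T$, the kernel of the Hankel operator $H_\Phi$ is $\ker H_\Phi=\{f=(f_1,\dots,f_n)^t\in H^2_{\mathbb C^n}:\ \phi_1f_1+\cdots+\phi_nf_n\in H^1\}$. *)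

(* Defs.v *)
From HB Require Import structures.
From mathcomp Require Import all_boot all_order all_algebra.
From mathcomp Require Import all_classical all_reals all_analysis.
From mathcomp Require Import complex.
Set Implicit Arguments. Unset Strict Implicit. Unset Printing Implicit Defensive.
Import Order.TTheory GRing.Theory Num.Theory.
Local Open Scope classical_set_scope.
Local Open Scope ring_scope.

(* The unit circle T is parametrized by t in [0, 2 pi] via t |-> e^{it};
   a function on T is a function R -> R[i] considered on [0, 2pi],
   with (normalized or not: irrelevant here) Lebesgue measure. *)
Section Hardy.
Variable R : realType.
Local Notation C := R[i].
Local Notation mu := (@lebesgue_measure R).

Definition Tdom : set R := `[0%R, (2 * pi)%R]%classic.

Definition cexp (m : int) (t : R) : C :=
  Complex (cos (m%:~R * t)) (sin (m%:~R * t)).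

Definition cmeasurable (f : R -> C) : Prop :=
  measurable_fun Tdom (fun t => complex.Re (f t)) /\
  measurable_fun Tdom (fun t => complex.Im (f t)).

Definition inL (p : nat) (f : R -> C) : Prop :=
  cmeasurable f /\
  (\int[mu]_(t in Tdom) ((ComplexField.Normc.normc (f t)) ^+ p)%:E < +oo)%E.

Definition inLinf (f : R -> C) : Prop :=
  cmeasurable f /\
  exists M : R, {ae mu, forall t, Tdom t -> ComplexField.Normc.normc (f t) <= M}.

(* m-th Fourier coefficient (up to the factor 1/(2 pi)):
   \int_0^{2pi} f(t) e^{-imt} dt *)
Definition fourier (f : R -> C) (m : int) : C :=
  Complex (Rintegral mu Tdom (fun t => complex.Re (f t * cexp (- m) t)))
          (Rintegral mu Tdom (fun t => complex.Im (f t * cexp (- m) t))).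

Definition analytic_coeffs (f : R -> C) : Prop :=
  forall m : int, (m < 0)%R -> fourier f m = 0.

Definition Hp (p : nat) (f : R -> C) : Prop := inL p f /\ analytic_coeffs f.
Definition Hinf (f : R -> C) : Prop := inLinf f /\ analytic_coeffs f.

Definition H2vec (n : nat) (f : 'cV[R -> C]_n) : Prop :=
  forall i, Hp 2 (f i ord0).

Definition inner_col (n : nat) (Theta : 'cV[R -> C]_n) : Prop :=
  (forall i, Hinf (Theta i ord0)) /\
  {ae mu, forall t, Tdom t -> \sum_(i < n) (ComplexField.Normc.normc (Theta i ord0 t)) ^+ 2 = 1}.

Definition meas_row (n : nat) (Phi : 'rV[R -> C]_n) : Prop :=
  forall j, cmeasurable (Phi ord0 j).

Definition in_ThetaH2 (n : nat) (Theta : 'cV[R -> C]_n) (f : 'cV[R -> C]_n) : Prop :=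
  H2vec f /\
  exists g : R -> C, Hp 2 g /\
    {ae mu, forall t, Tdom t -> forall i, f i ord0 t = Theta i ord0 t * g t}.

Definition in_kerHankel (n : nat) (Phi : 'rV[R -> C]_n) (f : 'cV[R -> C]_n) : Prop :=
  H2vec f /\ Hp 1 (fun t => \sum_(i < n) Phi ord0 i t * f i ord0 t).

End Hardy.

(* Main.v *)
(* Write k_1, ..., k_n for the entries of Theta and, for f in H^2, let F_ij be the
   minor k_i f_j - k_j f_i. Since sum |k_i|^2 = 1, f = Theta g forces g = Theta^* f,
   and f belongs to Theta H^2 iff all F_ij vanish and Theta^* f is analytic. Take for
   Phi the row with Phi f = Theta^* f + sum w_ij F_ij, where the weights w_ij have
   disjoint supports and blow up so fast at a point t_ij that w_ij F in L^1 forces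
   F = 0 for every F in H^2. Then Phi (Theta g) = g, and Phi f in L^1 already forces
   every F_ij = 0, so that Phi f = Theta^* f.

   The weights come from peak functions: for every arc around t_ij there are powers
   q of some quotient (1 - a z) / (1 - b z), z = e^{it}, with q(0) = 1 that are
   arbitrarily small off the arc. For analytic F the integral of F q is F^(0), so if
   (k + 1) |q_k| <= 1 + w for a sequence of such q_k, then |F^(0)| = O(1 / k); dividing
   by z and repeating kills all Fourier coefficients.

   That F_ij is analytic, and that F = 0 once its coefficients vanish, both follow
   from the density of trigonometric polynomials in L^2 of the circle. *)
Require Import Defs.
From mathcomp Require Import all_boot all_order all_algebra.
From mathcomp Require Import all_classical all_reals all_analysis.
From mathcomp Require Import measurable_realfun complex ring lra.

Set Implicit Arguments. Unset Strict Implicit. Unset Printing Implicit Defensive.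
Import Order.TTheory GRing.Theory Num.Theory numFieldNormedType.Exports.
Import ComplexField.Normc.
Local Open Scope classical_set_scope.
Local Open Scope complex_scope.
Local Open Scope ring_scope.

Local Notation Re := complex.Re.
Local Notation Im := complex.Im.

Section ComplexModulus.
Variable R : rcfType.
Implicit Types x y : R[i].

Lemma ReM x y : Re (x * y) = Re x * Re y - Im x * Im y.
Proof. by case: x; case: y. Qed.

Lemma ImM x y : Im (x * y) = Re x * Im y + Im x * Re y.
Proof. by case: x; case: y. Qed.

Lemma complex_ext x y : Re x = Re y -> Im x = Im y -> x = y.
Proof. by case: x y => a b [c d] /= -> ->. Qed.

Lemma normc_ge0 x : 0 <= normc x.
Proof. exact: (@normr_ge0 _ (Rcomplex R)). Qed.

Lemma normc_le_sum I (s : seq I) (P : pred I) (F : I -> R[i]) :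
  normc (\sum_(i <- s | P i) F i) <= \sum_(i <- s | P i) normc (F i).
Proof. exact: (@ler_norm_sum _ (Rcomplex R)). Qed.

Lemma normcX x n : normc (x ^+ n) = normc x ^+ n.
Proof.
elim: n => [|n IHn]; first by rewrite normc1.
by rewrite !exprS normcM IHn.
Qed.

Lemma normc_conjc x : normc x^* = normc x.
Proof. by case: x => a b /=; rewrite sqrrN. Qed.

Lemma normc_real (a : R) : normc a%:C = `|a|.
Proof. by rewrite /= expr0n addr0 sqrtr_sqr. Qed.

Lemma sqr_normc_ReIm x : normc x ^+ 2 = Re x ^+ 2 + Im x ^+ 2.
Proof. by case: x => a b /=; rewrite sqr_sqrtr// addr_ge0// sqr_ge0. Qed.

Lemma mulc_conjc x : x * x^* = (normc x ^+ 2)%:C.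
Proof.
rewrite sqr_normc_ReIm; case: x => a b.
by apply: complex_ext; rewrite ?ReM ?ImM /=; ring.
Qed.

Lemma sqr_normcB x y :
  normc (x - y) ^+ 2 = normc x ^+ 2 + normc y ^+ 2 - Re (x * y^*) * 2.
Proof. by rewrite !sqr_normc_ReIm; case: x y => a b [c d] /=; ring. Qed.

Lemma sqr_normcD_le x y : normc (x + y) ^+ 2 <= 2 * (normc x ^+ 2 + normc y ^+ 2).
Proof.
rewrite -subr_ge0.
have -> : 2 * (normc x ^+ 2 + normc y ^+ 2) - normc (x + y) ^+ 2 = normc (x - y) ^+ 2.
  by rewrite !sqr_normc_ReIm; case: x y => a b [c d] /=; ring.
exact: sqr_ge0.
Qed.

Lemma normr_Re_le x : `|Re x| <= normc x.
Proof. by rewrite -lecR; exact: normc_ge_Re. Qed.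

Lemma normr_Im_le x : `|Im x| <= normc x.
Proof.
rewrite -ler_sqr ?nnegrE ?normc_ge0// sqr_normc_ReIm real_normK ?num_real//.
by rewrite lerDr sqr_ge0.
Qed.

Lemma normc_le_ReIm x : normc x <= `|Re x| + `|Im x|.
Proof.
rewrite -ler_sqr ?nnegrE ?normc_ge0 ?addr_ge0// sqr_normc_ReIm sqrrD.
by rewrite !real_normK ?num_real// addrAC lerDl mulrn_wge0// mulr_ge0.
Qed.

End ComplexModulus.

Section RealIntegrals.
Context d (X : measurableType d) (R : realType) (mu : {measure set X -> \bar R}).
Variables (D : set X) (mD : measurable D).
Implicit Types u v : X -> R.

Lemma measurable_funV_ge0 u : (forall x, 0 <= u x) ->
  measurable_fun D u -> measurable_fun D (fun x => (u x)^-1).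
Proof.
move=> u0 u_meas; under eq_fun do rewrite -powR_inv1//.
exact: (measurableT_comp (measurable_powR (- 1))).
Qed.

Lemma integrable_EFinMr (r : R) u : mu.-integrable D (EFin \o u) ->
  mu.-integrable D (EFin \o fun x => u x * r).
Proof. by move=> iu; apply: eq_integrable (integrableZr mD r iu). Qed.

Lemma le_integrable_sqr u v : measurable_fun D v -> (forall x, `|v x| <= `|u x|) ->
  mu.-integrable D (EFin \o fun x => u x ^+ 2) ->
  mu.-integrable D (EFin \o fun x => v x ^+ 2).
Proof.
move=> v_meas vu; apply: le_integrable => //.
  by apply/measurable_EFinP; exact: measurable_funX.
by move=> x _; rewrite /= lee_fin !normrX lerXn2r ?nnegrE.
Qed.

Lemma ae_ge0_le_Rintegral u v :
  mu.-integrable D (EFin \o u) -> mu.-integrable D (EFin \o v) ->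
  (forall x, 0 <= u x) -> (forall x, 0 <= v x) ->
  {ae mu, forall x, D x -> u x <= v x} ->
  \int[mu]_(x in D) u x <= \int[mu]_(x in D) v x.
Proof.
move=> iu iv u0 v0 uv.
apply: fine_le; [exact: integrable_fin_num|exact: integrable_fin_num|].
have [/integrableP[u_meas _] /integrableP[v_meas _]] := (iu, iv).
by apply: ae_ge0_le_integral => // x _; rewrite lee_fin.
Qed.

End RealIntegrals.

Section Circle.
Variable R : realType.
Local Notation C := R[i].
Local Notation mu := (@lebesgue_measure R).
Local Notation T := (@Tdom R).
Implicit Types f g : R -> C.

Lemma measurable_Tdom : measurable (T : set (measurableTypeR R)).
Proof. exact: measurable_itv. Qed.
#[local] Hint Resolve measurable_Tdom : core.

Lemma lebesgue_measure_Tdom : mu T = (2 * pi)%:E.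
Proof.
by rewrite /Tdom lebesgue_measure_itv/= lte_fin mulr_gt0 ?pi_gt0// oppr0 addr0.
Qed.

Lemma lebesgue_measure_Tdom_lty : (mu T < +oo)%E.
Proof. by rewrite lebesgue_measure_Tdom ltry. Qed.

#[export] Instance ae_lebesgue_filter : Filter (almost_everywhere mu) :=
  ae_filter_ringOfSetsType mu.

Lemma ae_neq (b : R) : {ae mu, forall t, t <> b}.
Proof.
exists [set b]; split; [exact: measurable_set1|exact: lebesgue_measure_set1|].
by move=> t /= /contrapT.
Qed.

Lemma cmeasurable_cst (c : C) : cmeasurable (fun=> c).
Proof. by []. Qed.

Lemma cmeasurable_real (w : R -> R) : measurable_fun T w ->
  cmeasurable (fun t => (w t)%:C).
Proof. by move=> mw; split => //=; exact: measurable_cst. Qed.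

Lemma cmeasurable_conjc f : cmeasurable f -> cmeasurable (fun t => (f t)^*).
Proof.
move=> [mRe mIm]; split.
  by apply: eq_measurable_fun mRe => t _; case: (f t).
by apply: eq_measurable_fun (measurable_funN mIm) => t _ /=; case: (f t).
Qed.

Lemma cmeasurableD f g : cmeasurable f -> cmeasurable g -> cmeasurable (fun t => f t + g t).
Proof.
move=> [fRe fIm] [gRe gIm]; split.
  by under eq_fun do rewrite raddfD; exact: measurable_funD.
by under eq_fun do rewrite raddfD; exact: measurable_funD.
Qed.

Lemma cmeasurableM f g : cmeasurable f -> cmeasurable g -> cmeasurable (fun t => f t * g t).
Proof.
move=> [fRe fIm] [gRe gIm]; split.
  by under eq_fun do rewrite ReM; apply: measurable_funB; exact: measurable_funM.
by under eq_fun do rewrite ImM; apply: measurable_funD; exact: measurable_funM.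
Qed.

Lemma cmeasurableMl (c : C) f : cmeasurable f -> cmeasurable (fun t => c * f t).
Proof. by apply: cmeasurableM; exact: cmeasurable_cst. Qed.

Lemma cmeasurableB f g : cmeasurable f -> cmeasurable g -> cmeasurable (fun t => f t - g t).
Proof.
move=> mf mg; under eq_fun do rewrite -mulN1r.
by apply: cmeasurableD => //; exact: cmeasurableMl.
Qed.

Lemma cmeasurable_sum I (s : seq I) (P : pred I) (F : I -> R -> C) :
  (forall i, cmeasurable (F i)) -> cmeasurable (fun t => \sum_(i <- s | P i) F i t).
Proof.
move=> mF; elim: s => [|i s IHs].
  by under eq_fun do rewrite big_nil; exact: cmeasurable_cst.
by under eq_fun do rewrite big_cons; case: (P i) => //; exact: cmeasurableD.
Qed.

Lemma measurable_normc f : cmeasurable f -> measurable_fun T (fun t => normc (f t)).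
Proof.
move=> [mRe mIm].
have -> : (fun t => normc (f t)) = Num.sqrt \o (fun t => Re (f t) ^+ 2 + Im (f t) ^+ 2).
  by apply/funext => t /=; case: (f t).
apply: measurableT_comp; first exact: (continuous_measurable_fun (@sqrt_continuous R)).
by apply: measurable_funD; exact: measurable_funX.
Qed.

Lemma cmeasurableV f : cmeasurable f -> cmeasurable (fun t => (f t)^-1).
Proof.
move=> mf; have invE (z : C) : z^-1 = z^* * ((normc z ^+ 2)^-1)%:C.
  by rewrite fmorphV rmorphXn mulrC; exact: invc_norm.
under eq_fun do rewrite invE; apply: cmeasurableM; first exact: cmeasurable_conjc.
apply: cmeasurable_real; apply: measurable_funV_ge0 => [t|]; first exact: sqr_ge0.
by apply: measurable_funX; exact: measurable_normc.
Qed.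

Lemma measurable_EFin_normcX f n : cmeasurable f ->
  measurable_fun T (fun t => (normc (f t) ^+ n)%:E).
Proof. by move=> mf; apply/measurable_EFinP/measurable_funX; exact: measurable_normc. Qed.

Definition cintegrable f :=
  mu.-integrable T (EFin \o fun t => Re (f t)) /\ mu.-integrable T (EFin \o fun t => Im (f t)).

Definition cint f : C :=
  Complex (\int[mu]_(t in T) Re (f t)) (\int[mu]_(t in T) Im (f t)).

Lemma cintegrable_cmeasurable f : cintegrable f -> cmeasurable f.
Proof.
by move=> [/integrableP[? _] /integrableP[? _]]; split; exact/measurable_EFinP.
Qed.

Lemma cintegrable_dominated f (h : R -> R) : cmeasurable f ->
  mu.-integrable T (EFin \o h) -> (forall t, T t -> normc (f t) <= h t) -> cintegrable f.
Proof.
move=> [mRe mIm] ih fh; split; apply: le_integrable ih => //; try exact/measurable_EFinP.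
- move=> t /fh fht; rewrite /= lee_fin (le_trans (normr_Re_le _))//.
  by rewrite (le_trans fht)// ler_norm.
- move=> t /fh fht; rewrite /= lee_fin (le_trans (normr_Im_le _))//.
  by rewrite (le_trans fht)// ler_norm.
Qed.

Lemma integrable_normc f : cintegrable f -> mu.-integrable T (EFin \o fun t => normc (f t)).
Proof.
move=> fL1; have mf := cintegrable_cmeasurable fL1; have [iRe iIm] := fL1.
have := integrableD measurable_Tdom (integrable_abse iRe) (integrable_abse iIm).
apply: le_integrable => //; first by apply/measurable_EFinP; exact: measurable_normc.
move=> t _; rewrite /= lee_fin ger0_norm ?normc_ge0// ger0_norm ?addr_ge0//.
exact: normc_le_ReIm.
Qed.

Lemma inL1P f : inL 1 f <-> cintegrable f.
Proof.
split=> [[mf fL1]|fL1].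
  apply: (cintegrable_dominated (h := fun t => normc (f t))) => //.
  apply/integrableP; split; first by apply/measurable_EFinP; exact: measurable_normc.
  by under eq_integral do rewrite /= ger0_norm ?normc_ge0// -[normc _]expr1.
split; first exact: cintegrable_cmeasurable.
have /integrableP[_] := integrable_normc fL1.
by under eq_integral do rewrite /= ger0_norm ?normc_ge0// -[normc _]expr1.
Qed.

Lemma cintegrableD f g : cintegrable f -> cintegrable g -> cintegrable (fun t => f t + g t).
Proof.
move=> [fRe fIm] [gRe gIm]; split.
  apply: eq_integrable (integrableD measurable_Tdom fRe gRe) => // t _.
  by rewrite /= raddfD.
apply: eq_integrable (integrableD measurable_Tdom fIm gIm) => // t _.
by rewrite /= raddfD.
Qed.

Lemma cintD f g : cintegrable f -> cintegrable g ->
  cint (fun t => f t + g t) = cint f + cint g.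
Proof.
move=> [fRe fIm] [gRe gIm]; apply: complex_ext; rewrite raddfD /=.
  by under eq_Rintegral do rewrite raddfD; rewrite RintegralD.
by under eq_Rintegral do rewrite raddfD; rewrite RintegralD.
Qed.

Lemma cintegrableMr_bounded f g (M : R) : cintegrable f -> cmeasurable g ->
  (forall t, T t -> normc (g t) <= M) -> cintegrable (fun t => f t * g t).
Proof.
move=> fL1 mg gM.
apply: (cintegrable_dominated _ (integrableZl measurable_Tdom M (integrable_normc fL1))).
  by apply: cmeasurableM => //; exact: cintegrable_cmeasurable.
by move=> t Tt; rewrite /= normcM mulrC ler_wpM2r ?normc_ge0// gM.
Qed.

Lemma cintegrableZr (c : C) f : cintegrable f -> cintegrable (fun t => f t * c).
Proof. by move=> fL1; apply: (cintegrableMr_bounded fL1 (M := normc c)). Qed.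

Lemma cintZr (c : C) f : cintegrable f -> cint (fun t => f t * c) = cint f * c.
Proof.
move=> [iRe iIm]; apply: complex_ext; rewrite ?ReM ?ImM /=.
  under eq_Rintegral do rewrite ReM.
  by rewrite RintegralB ?RintegralZr//; exact: integrable_EFinMr.
under eq_Rintegral do rewrite ImM.
by rewrite RintegralD ?RintegralZr//; exact: integrable_EFinMr.
Qed.

Lemma cintegrableB f g : cintegrable f -> cintegrable g -> cintegrable (fun t => f t - g t).
Proof.
move=> fL1 gL1; under eq_fun do rewrite -mulrN1.
by apply: cintegrableD => //; exact: cintegrableZr.
Qed.

Lemma cintB f g : cintegrable f -> cintegrable g ->
  cint (fun t => f t - g t) = cint f - cint g.
Proof.
move=> fL1 gL1; under [in LHS]eq_fun do rewrite -mulrN1.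
by rewrite cintD ?cintZr ?mulrN1//; exact: cintegrableZr.
Qed.

Lemma integrable_Tdom_cst (r : R) : mu.-integrable T (EFin \o cst r).
Proof.
apply: measurable_bounded_integrable => //; first exact: lebesgue_measure_Tdom_lty.
exact: bounded_cst.
Qed.

Lemma cintegrable_cst (c : C) : cintegrable (fun=> c).
Proof. by split; exact: integrable_Tdom_cst. Qed.

Lemma cintegrable_sum I (s : seq I) (F : I -> R -> C) :
  (forall i, cintegrable (F i)) -> cintegrable (fun t => \sum_(i <- s) F i t).
Proof.
move=> FL1; elim: s => [|i s IHs].
  by under eq_fun do rewrite big_nil; exact: cintegrable_cst.
by under eq_fun do rewrite big_cons; exact: cintegrableD.
Qed.

Lemma cint_sum I (s : seq I) (F : I -> R -> C) : (forall i, cintegrable (F i)) ->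
  cint (fun t => \sum_(i <- s) F i t) = \sum_(i <- s) cint (F i).
Proof.
move=> FL1; elim: s => [|i s IHs].
  under eq_fun do rewrite big_nil.
  by rewrite big_nil; apply: complex_ext; rewrite /= Rintegral_cst// mul0r.
under eq_fun do rewrite big_cons.
by rewrite big_cons -IHs cintD//; exact: cintegrable_sum.
Qed.

Lemma ae_eq_cint f g : cmeasurable f -> cmeasurable g ->
  {ae mu, forall t, T t -> f t = g t} -> cint f = cint g.
Proof.
move=> [fRe fIm] [gRe gIm] fg.
by congr Complex; congr fine; apply: ae_eq_integral => //; try exact/measurable_EFinP;
  apply: filterS fg => t fg Tt; rewrite fg.
Qed.

Lemma ae_eq_cintegrable f g : cmeasurable f -> cintegrable g ->
  {ae mu, forall t, T t -> f t = g t} -> cintegrable f.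
Proof.
move=> mf /inL1P[mg gL1] fg; apply/inL1P; split => //; apply: le_lt_trans gL1.
apply: ae_ge0_le_integral => //; try exact: measurable_EFin_normcX.
- by move=> t _; rewrite lee_fin exprn_ge0// normc_ge0.
- by move=> t _; rewrite lee_fin exprn_ge0// normc_ge0.
- by apply: filterS fg => t fg Tt; rewrite fg.
Qed.

Lemma normc_cint_le f : cintegrable f -> normc (cint f) <= \int[mu]_(t in T) normc (f t).
Proof.
move=> fL1; have [c0|c0] := eqVneq (normc (cint f)) 0.
  by rewrite c0; apply: Rintegral_ge0 => t _; exact: normc_ge0.
have {}c0 : 0 < normc (cint f) by rewrite lt_def c0 normc_ge0.
have inf := integrable_normc fL1.
rewrite -(ler_pM2r c0) -expr2 -RintegralZr//.
have -> : normc (cint f) ^+ 2 = Re (cint (fun t => f t * (cint f)^*)).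
  by rewrite cintZr// mulc_conjc.
apply: le_Rintegral => //; first by case: (cintegrableZr (cint f)^* fL1).
  exact: integrable_EFinMr.
move=> t _; rewrite -[normc (cint f)]normc_conjc -normcM.
exact: le_trans (ler_norm _) (normr_Re_le _).
Qed.

End Circle.

Arguments measurable_Tdom R : clear implicits.
#[export] Hint Resolve measurable_Tdom : core.

Section SquareIntegrable.
Variable R : realType.
Local Notation C := R[i].
Local Notation mu := (@lebesgue_measure R).
Local Notation T := (@Tdom R).
Implicit Types f g h k : R -> C.

Definition L2sq f : \bar R := (\int[mu]_(t in T) (normc (f t) ^+ 2)%:E)%E.

Lemma L2sq_ge0 f : (0 <= L2sq f)%E.
Proof. by apply: integral_ge0 => t _; rewrite lee_fin sqr_ge0. Qed.

Lemma inL2_integrable f : inL 2 f ->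
  mu.-integrable T (EFin \o fun t => normc (f t) ^+ 2).
Proof.
move=> [mf fL2]; apply/integrableP; split; first exact: measurable_EFin_normcX.
by under eq_integral do rewrite /= ger0_norm ?sqr_ge0//.
Qed.

Lemma L2sqE f : inL 2 f -> L2sq f = (\int[mu]_(t in T) normc (f t) ^+ 2)%:E.
Proof. by move=> [_ fL2]; rewrite fineK// ge0_fin_numE// L2sq_ge0. Qed.

Lemma L2sqD_le f g : cmeasurable f -> cmeasurable g ->
  (L2sq (fun t => (f t + g t)%R) <= 2%:E * (L2sq f + L2sq g))%E.
Proof.
move=> mf mg; have mfX := measurable_EFin_normcX 2 mf.
have mgX := measurable_EFin_normcX 2 mg.
rewrite /L2sq -ge0_integralD//; [|by move=> t _; rewrite lee_fin sqr_ge0..].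
rewrite -ge0_integralZl//; first last.
- by move=> t _; rewrite -EFinD lee_fin addr_ge0// sqr_ge0.
- exact: emeasurable_funD.
apply: ge0_le_integral => //.
- by move=> t _; rewrite lee_fin sqr_ge0.
- by apply: measurable_EFin_normcX; exact: cmeasurableD.
- by apply: measurable_funeM; exact: emeasurable_funD.
- by move=> t _; rewrite -EFinD -EFinM lee_fin sqr_normcD_le.
Qed.

Lemma L2sqD_le_small f g (e : R) : cmeasurable f -> cmeasurable g ->
  (L2sq f <= (e / 4)%:E)%E -> (L2sq g <= (e / 4)%:E)%E ->
  (L2sq (fun t => (f t + g t)%R) <= e%:E)%E.
Proof.
move=> mf mg fe ge; apply: le_trans (L2sqD_le mf mg) _.
have -> : e = 2 * (e / 4 + e / 4) by field.
by rewrite EFinM lee_pmul2l// EFinD leeD.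
Qed.

Lemma ae_L2sq_le f g (c : R) : 0 <= c -> cmeasurable f -> cmeasurable g ->
  {ae mu, forall t, T t -> normc (f t) <= c * normc (g t)} ->
  (L2sq f <= (c ^+ 2)%:E * L2sq g)%E.
Proof.
move=> c0 mf mg fg; have mgX := measurable_EFin_normcX 2 mg.
rewrite /L2sq -ge0_integralZl//; [|by move=> t _; rewrite lee_fin sqr_ge0|
  by rewrite lee_fin sqr_ge0].
apply: ae_ge0_le_integral => //.
- by move=> t _; rewrite lee_fin sqr_ge0.
- exact: measurable_EFin_normcX.
- by move=> t _; rewrite -EFinM lee_fin mulr_ge0// sqr_ge0.
- exact: measurable_funeM.
- apply: filterS fg => t fg Tt; rewrite -EFinM lee_fin -exprMn.
  by rewrite ler_sqr ?nnegrE ?mulr_ge0 ?normc_ge0// fg.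
Qed.

Lemma inL2_cst (c : C) : inL 2 (fun _ : R => c).
Proof.
split; first exact: cmeasurable_cst.
rewrite integral_cst// lte_mul_pinfty// ?lee_fin ?sqr_ge0//.
exact: lebesgue_measure_Tdom_lty.
Qed.

Lemma inL2D f g : inL 2 f -> inL 2 g -> inL 2 (fun t => f t + g t).
Proof.
move=> [mf fL2] [mg gL2]; split; first exact: cmeasurableD.
apply: le_lt_trans (L2sqD_le mf mg) _; rewrite lte_mul_pinfty//.
exact: lte_add_pinfty.
Qed.

Lemma inL2_conjc f : inL 2 f -> inL 2 (fun t => (f t)^*).
Proof.
move=> [mf fL2]; split; first exact: cmeasurable_conjc.
by under eq_integral do rewrite normc_conjc.
Qed.

Lemma inL2Ml k f : inLinf k -> inL 2 f -> inL 2 (fun t => k t * f t).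
Proof.
move=> [mk [M kM]] [mf fL2]; split; first exact: cmeasurableM.
apply: le_lt_trans (_ : _ <= (`|M| ^+ 2)%:E * L2sq f)%E _; last first.
  by rewrite lte_mul_pinfty// lee_fin sqr_ge0.
apply: ae_L2sq_le => //; first exact: cmeasurableM.
apply: filterS kM => t kM Tt; rewrite normcM.
by rewrite ler_wpM2r ?normc_ge0// (le_trans (kM Tt))// ler_norm.
Qed.

Lemma inL2B f g : inL 2 f -> inL 2 g -> inL 2 (fun t => f t - g t).
Proof.
move=> [mf fL2] [mg gL2]; apply: inL2D => //; split.
  by under eq_fun do rewrite -mulN1r; exact: cmeasurableMl.
by under eq_integral do rewrite normcN.
Qed.

Lemma inL2_sum I (s : seq I) (F : I -> R -> C) :
  (forall i, inL 2 (F i)) -> inL 2 (fun t => \sum_(i <- s) F i t).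
Proof.
move=> FL2; elim: s => [|i s IHs].
  by under eq_fun do rewrite big_nil; exact: inL2_cst.
by under eq_fun do rewrite big_cons; exact: inL2D.
Qed.

Lemma inLinf_inL2 k : inLinf k -> inL 2 k.
Proof.
by move=> kLinf; have := inL2Ml kLinf (inL2_cst 1); under eq_fun do rewrite mulr1.
Qed.

Lemma inLinf_conjc k : inLinf k -> inLinf (fun t => (k t)^*).
Proof.
move=> [mk [M kM]]; split; first exact: cmeasurable_conjc.
by exists M; apply: filterS kM => t kM Tt; rewrite normc_conjc kM.
Qed.

Lemma bounded_inLinf k (M : R) : cmeasurable k ->
  (forall t, normc (k t) <= M) -> inLinf k.
Proof. by move=> mk kM; split => //; exists M; apply: aeW => t _. Qed.

Lemma inL2M_cintegrable f g : inL 2 f -> inL 2 g -> cintegrable (fun t => f t * g t).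
Proof.
move=> fL2 gL2; apply: (cintegrable_dominated _ (integrableD (measurable_Tdom R)
  (inL2_integrable fL2) (inL2_integrable gL2))).
  by apply: cmeasurableM; [case: fL2|case: gL2].
move=> t _; rewrite /= normcM.
by have := normc_ge0 (f t); have := normc_ge0 (g t); nra.
Qed.

Lemma inL2_cintegrable f : inL 2 f -> cintegrable f.
Proof. by move=> /inL2M_cintegrable/(_ (inL2_cst 1)); under eq_fun do rewrite mulr1. Qed.

(* Through the discriminant of the nonnegative quadratic [r |-> \int (r |g| + |h|)^2]. *)
Lemma cauchy_schwarz_cint g h : inL 2 g -> inL 2 h ->
  ((normc (cint (fun t => g t * h t)) ^+ 2)%:E <= L2sq g * L2sq h)%E.
Proof.
move=> gL2 hL2; rewrite (L2sqE gL2) (L2sqE hL2) -EFinM lee_fin.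
have ig := inL2_integrable gL2; have ih := inL2_integrable hL2.
have gh_L1 := inL2M_cintegrable gL2 hL2; have igh := integrable_normc gh_L1.
have X_ge0 : 0 <= \int[mu]_(t in T) normc (g t * h t).
  by apply: Rintegral_ge0 => t _; exact: normc_ge0.
apply: le_trans (_ : (\int[mu]_(t in T) normc (g t * h t)) ^+ 2 <= _).
  by rewrite ler_sqr ?nnegrE ?normc_ge0// normc_cint_le.
set X := Rintegral _ _ _; set G := Rintegral _ _ _; set H := Rintegral _ _ _.
pose p := Poly [:: H; 2 * X; G].
have p_ge0 r : 0 <= p.[r].
  have -> : p.[r] = \int[mu]_(t in T) (r * normc (g t) + normc (h t)) ^+ 2.
    transitivity (\int[mu]_(t in T) (normc (g t) ^+ 2 * r ^+ 2 +
        normc (g t * h t) * (2 * r) + normc (h t) ^+ 2)).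
      have ig' := integrable_EFinMr (measurable_Tdom R) (r ^+ 2) ig.
      have igh' := integrable_EFinMr (measurable_Tdom R) (2 * r) igh.
      rewrite RintegralD ?(RintegralD _ ig' igh')//; last first.
        exact: (integrableD (measurable_Tdom R) ig' igh').
      by rewrite !RintegralZr// horner_Poly /= -/X -/G -/H; ring.
    by apply: eq_Rintegral => t _; rewrite normcM; ring.
  by apply: Rintegral_ge0 => t _; exact: sqr_ge0.
have := deg_le2_poly_ge0 (size_Poly _ : (size p <= 3)%N) p_ge0.
by rewrite /p !coef_Poly /=; lra.
Qed.

Lemma cint_eq0_of_small g (X : C) : inL 2 g ->
  (forall e : R, 0 < e -> exists h, [/\ inL 2 h, (L2sq h <= e%:E)%E
     & X = cint (fun t => g t * h t)]) -> X = 0.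
Proof.
move=> gL2 small; apply: eq0_normc; apply/eqP.
rewrite -sqrf_eq0 eq_le sqr_ge0 andbT; apply/ler_addgt0Pl => e e0; rewrite addr0.
set G := \int[mu]_(t in T) normc (g t) ^+ 2.
have G0 : 0 <= G by apply: Rintegral_ge0 => t _; exact: sqr_ge0.
have eG0 : 0 < e / (G + 1) by rewrite divr_gt0// ltr_wpDl.
have [h [hL2 he ->]] := small _ eG0.
rewrite -lee_fin (le_trans (cauchy_schwarz_cint gL2 hL2))// (L2sqE gL2).
apply: le_trans (_ : _ <= G%:E * (e / (G + 1))%:E)%E _; first exact: lee_wpmul2l.
by rewrite -EFinM lee_fin mulrA ler_pdivrMr ?ltr_wpDl//; nra.
Qed.

Lemma L2sq_eq0_ae f : inL 2 f -> L2sq f = 0%E -> {ae mu, forall t, T t -> f t = 0}.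
Proof.
move=> [mf _] f0.
have := (ae_eq_integral_abs mu (measurable_Tdom R) (measurable_EFin_normcX 2 mf)).1.
rewrite (_ : integral _ _ _ = L2sq f); last first.
  by apply: eq_integral => t _; rewrite abse_EFin ger0_norm ?sqr_ge0.
move=> /(_ f0); apply: filterS => t ft Tt.
have [] := ft Tt => /eqP; rewrite sqrf_eq0 => /eqP.
exact: eq0_normc.
Qed.

Lemma L2sqB_orthogonal f g : inL 2 f -> inL 2 g -> cint (fun t => f t * (g t)^*) = 0 ->
  L2sq (fun t => (f t - g t)%R) = (L2sq f + L2sq g)%E.
Proof.
move=> fL2 gL2 fg0; rewrite !L2sqE//; last exact: inL2B.
have ifg := (inL2M_cintegrable fL2 (inL2_conjc gL2)).1.
have i_f := inL2_integrable fL2; have ig := inL2_integrable gL2.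
rewrite -EFinD -RintegralD//; congr EFin.
under eq_Rintegral do rewrite sqr_normcB.
rewrite RintegralB//; first last.
- exact: integrable_EFinMr.
- exact: (integrableD (measurable_Tdom R) i_f ig).
rewrite RintegralZr// [X in _ - X * 2](_ : _ = 0) ?mul0r ?subr0//.
exact: (congr1 (@complex.Re R) fg0).
Qed.

End SquareIntegrable.

Section Fourier.
Variable R : realType.
Local Notation C := R[i].
Local Notation mu := (@lebesgue_measure R).
Local Notation T := (@Tdom R).
Implicit Types f g : R -> C.

Lemma cexpD (m n : int) (t : R) : cexp (m + n) t = cexp m t * cexp n t.
Proof.
by apply: complex_ext; rewrite ?ReM ?ImM /= rmorphD mulrDl ?cosD ?sinD// addrC.
Qed.

Lemma cexp0 (t : R) : cexp 0 t = 1.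
Proof. by rewrite /cexp mul0r cos0 sin0. Qed.

Lemma cexpN (m : int) (t : R) : cexp (- m) t = (cexp m t)^*.
Proof. by rewrite /cexp /= rmorphN /= mulNr cosN sinN. Qed.

Lemma normc_cexp (m : int) (t : R) : normc (cexp m t) = 1.
Proof. by rewrite /= cos2Dsin2 sqrtr1. Qed.

Lemma cexp_2pi (m : int) : cexp m (2 * pi : R) = 1.
Proof.
suff cexp_nat (n : nat) : cexp n%:Z (2 * pi : R) = 1.
  by case: m => n; [exact: cexp_nat|rewrite NegzE cexpN cexp_nat rmorph1].
have -> : 2 * pi = pi *+ 2 :> R by rewrite mulr_natl.
rewrite /cexp -pmulrn mulr_natl -[_ *+ n]add0r.
by rewrite (periodicn (@cosD2pi R)) (periodicn (@sinD2pi R)) cos0 sin0.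
Qed.

Lemma cmeasurable_cexp (m : int) : cmeasurable (@cexp R m).
Proof.
have mM : measurable_fun T (fun t => m%:~R * t) by exact: measurable_funM.
split; apply: measurableT_comp mM; apply: continuous_measurable_fun.
  exact: continuous_cos.
exact: continuous_sin.
Qed.

Lemma inLinf_cexp (m : int) : inLinf (@cexp R m).
Proof.
by apply: (bounded_inLinf (M := 1)) => [|t]; [exact: cmeasurable_cexp|rewrite normc_cexp].
Qed.

Lemma cintegrableM_cexp f (m : int) : cintegrable f -> cintegrable (fun t => f t * cexp m t).
Proof.
move=> fL1; apply: (cintegrableMr_bounded fL1 (cmeasurable_cexp m) (M := 1)).
by move=> t _; rewrite normc_cexp.
Qed.

Lemma Rintegral_continuous_FTC2 (u U : R -> R) (a b : R) : a < b ->
  (forall x : R, is_derive x 1 U (u x)) -> continuous u ->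
  \int[mu]_(t in `[a, b]) u t = U b - U a.
Proof.
move=> ab dU cu; have cU : continuous U.
  by move=> x; apply/differentiable_continuous/derivable1_diffP; exact: ex_derive.
rewrite /Rintegral (@continuous_FTC2 _ u U)//.
- exact: continuous_subspaceT.
- split; first by move=> x _; exact: ex_derive.
    by apply: cvg_at_right_filter; exact: cU.
  by apply: cvg_at_left_filter; exact: cU.
- by move=> x _; rewrite derive1E; exact: derive_val.
Qed.

Lemma cint_cexp (m : int) : m != 0 -> cint (@cexp R m) = 0.
Proof.
move=> m0; have mR0 : (m%:~R : R) != 0 by rewrite intr_eq0.
have pi2_gt0 : (0 : R) < 2 * pi by rewrite mulr_gt0// pi_gt0.
have cM : continuous (fun t : R => m%:~R * t).
  by move=> t; apply: cvgM; [exact: cvg_cst|exact: cvg_id].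
have dM (t : R) : is_derive t 1 (fun t : R => m%:~R * t) m%:~R.
  by apply: is_derive_eq; rewrite /GRing.scale /= mulr1.
have dsin (t : R) :
    is_derive t 1 (fun t : R => m%:~R^-1 * sin (m%:~R * t)) (cos (m%:~R * t)).
  have := @is_derive1_comp _ sin _ t _ _ (is_derive_sin _) (dM t).
  by move=> dsin; apply: is_derive_eq; rewrite /GRing.scale /=; field.
have dcos (t : R) :
    is_derive t 1 (fun t : R => - m%:~R^-1 * cos (m%:~R * t)) (sin (m%:~R * t)).
  have := @is_derive1_comp _ cos _ t _ _ (is_derive_cos _) (dM t).
  by move=> dcos; apply: is_derive_eq; rewrite /GRing.scale /=; field.
have [cos2pi sin2pi] : cos (m%:~R * (2 * pi) : R) = 1 /\ sin (m%:~R * (2 * pi) : R) = 0.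
  by have [-> ->] := cexp_2pi m.
apply: complex_ext => /=.
  rewrite (Rintegral_continuous_FTC2 pi2_gt0 dsin) ?sin2pi ?mulr0 ?sin0 ?mulr0 ?subrr//.
  by move=> t; apply: continuous_comp; [exact: cM|exact: continuous_cos].
rewrite (Rintegral_continuous_FTC2 pi2_gt0 dcos) ?cos2pi ?mulr0 ?cos0 ?subrr//.
by move=> t; apply: continuous_comp; [exact: cM|exact: continuous_sin].
Qed.

Lemma fourierE f (m : int) : fourier f m = cint (fun t => f t * cexp (- m) t).
Proof. by []. Qed.

Lemma fourierB f g (m : int) : cintegrable f -> cintegrable g ->
  fourier (fun t => f t - g t) m = fourier f m - fourier g m.
Proof.
move=> fL1 gL1; rewrite !fourierE -cintB; try exact: cintegrableM_cexp.
by under eq_fun do rewrite mulrBl.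
Qed.

Lemma fourierZr f (c : C) (m : int) : cintegrable f ->
  fourier (fun t => f t * c) m = fourier f m * c.
Proof.
move=> fL1; rewrite !fourierE -cintZr; last exact: cintegrableM_cexp.
by under eq_fun do rewrite mulrAC.
Qed.

Lemma fourierM_cexp f (m n : int) : fourier (fun t => f t * cexp n t) m = fourier f (m - n).
Proof.
rewrite !fourierE; congr cint; apply/funext => t.
by rewrite -mulrA -cexpD opprB.
Qed.

Lemma ae_eq_fourier f g : cmeasurable f -> cmeasurable g ->
  {ae mu, forall t, T t -> f t = g t} -> fourier f = fourier g.
Proof.
move=> mf mg fg; apply/funext => m; rewrite !fourierE.
have mexp := cmeasurable_cexp (- m).
apply: ae_eq_cint; [exact: cmeasurableM|exact: cmeasurableM|].
by apply: filterS fg => t fg Tt; rewrite fg.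
Qed.

Lemma normc_fourier_le f (m : int) : cintegrable f ->
  normc (fourier f m) <= \int[mu]_(t in T) normc (f t).
Proof.
move=> fL1; have := normc_cint_le (cintegrableM_cexp (- m) fL1).
by under eq_Rintegral do rewrite normcM normc_cexp mulr1.
Qed.

Lemma analytic_coeffsB f g : cintegrable f -> cintegrable g ->
  analytic_coeffs f -> analytic_coeffs g -> analytic_coeffs (fun t => f t - g t).
Proof. by move=> fL1 gL1 af ag m m0; rewrite fourierB// af// ag// subrr. Qed.

End Fourier.

Section TrigonometricPolynomials.
Variable R : realType.
Local Notation C := R[i].
Implicit Types (f p q : R -> C) (s : seq (int * C)).

Definition trigpoly s (t : R) : C := \sum_(x <- s) cexp x.1 t * x.2.

Definition is_trigpoly p := exists s, p =1 trigpoly s.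

Lemma conjc_trigpoly s (t : R) :
  (trigpoly s t)^* = trigpoly [seq (- x.1, x.2^*) | x <- s] t.
Proof.
rewrite /trigpoly rmorph_sum big_map; apply: eq_bigr => x _.
by rewrite /= rmorphM cexpN.
Qed.

Lemma is_trigpoly_cst (c : C) : is_trigpoly (fun=> c).
Proof. by exists [:: (0, c)] => t; rewrite /trigpoly big_seq1 cexp0 mul1r. Qed.

Lemma is_trigpolyD p q : is_trigpoly p -> is_trigpoly q -> is_trigpoly (fun t => p t + q t).
Proof. by move=> [s ps] [s' qs']; exists (s ++ s') => t; rewrite /trigpoly big_cat ps qs'. Qed.

Lemma is_trigpolyM p q : is_trigpoly p -> is_trigpoly q -> is_trigpoly (fun t => p t * q t).
Proof.
move=> [s ps] [s' qs']; exists [seq (x.1 + y.1, x.2 * y.2) | x <- s, y <- s'] => t.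
rewrite /trigpoly big_allpairs_dep ps qs' /trigpoly big_distrlr /=.
by apply: eq_bigr => x _; apply: eq_bigr => y _; rewrite cexpD mulrACA.
Qed.

Lemma is_trigpoly_cosB (a : R) : is_trigpoly (fun t => (cos (t - a))%:C).
Proof.
exists [:: (1, cexp (- 1) a / 2); (- 1, cexp 1 a / 2)] => t.
rewrite /trigpoly big_cons big_seq1 /= !mulrA -mulrDl !cexpN.
apply: (mulIf (_ : 2 != 0)); first by rewrite pnatr_eq0.
rewrite divfK ?pnatr_eq0//; apply: complex_ext; rewrite /= ?mul1r; last by ring.
by rewrite cosB; ring.
Qed.

Lemma is_trigpoly_horner (P : {poly R}) (u : R -> R) :
  is_trigpoly (fun t => (u t)%:C) -> is_trigpoly (fun t => (P.[u t])%:C).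
Proof.
move=> tu; elim/poly_ind: P => [|P c IHP].
  by under eq_fun do rewrite horner0; exact: is_trigpoly_cst.
under eq_fun do rewrite hornerMXaddC rmorphD rmorphM.
by apply: is_trigpolyD; [exact: is_trigpolyM|exact: is_trigpoly_cst].
Qed.

Lemma normc_trigpoly_le s (t : R) : normc (trigpoly s t) <= \sum_(x <- s) normc x.2.
Proof.
apply: le_trans (normc_le_sum _ _ _) _; apply: ler_sum => x _.
by rewrite normcM normc_cexp mul1r.
Qed.

Lemma inL2_trigpoly s : inL 2 (trigpoly s).
Proof.
apply/inLinf_inL2/(bounded_inLinf (M := \sum_(x <- s) normc x.2)); last first.
  exact: normc_trigpoly_le.
apply: cmeasurable_sum => x; apply: cmeasurableM; first exact: cmeasurable_cexp.
exact: cmeasurable_cst.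
Qed.

Lemma is_trigpoly_inL2 p : is_trigpoly p -> inL 2 p.
Proof. by move=> [s /funext ->]; exact: inL2_trigpoly. Qed.

Lemma cint_mul_trigpoly f s : cintegrable f ->
  cint (fun t => f t * trigpoly s t) = \sum_(x <- s) fourier f (- x.1) * x.2.
Proof.
move=> fL1; have fexp (m : int) := cintegrableM_cexp m fL1.
under eq_fun do rewrite /trigpoly mulr_sumr.
under eq_fun do under eq_bigr do rewrite mulrA.
rewrite cint_sum => [|x]; last exact: cintegrableZr.
by apply: eq_bigr => x _; rewrite cintZr// fourierE opprK.
Qed.

Lemma analytic_trigpoly s : all (fun x => 0 <= x.1) s -> analytic_coeffs (trigpoly s).
Proof.
move=> /allP s_ge0 m m0; rewrite fourierE.
under eq_fun do rewrite mulrC.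
rewrite cint_mul_trigpoly; last exact/inL2_cintegrable/inLinf_inL2/inLinf_cexp.
rewrite big1_seq// => x /andP[_ /s_ge0 x0].
rewrite fourierE opprK; under eq_fun do rewrite -cexpD.
by rewrite cint_cexp ?mul0r// gt_eqF// ltr_pwDl// oppr_gt0.
Qed.

End TrigonometricPolynomials.

Section StepPolynomials.
Variable R : realType.

Lemma bernoulli_le (K : realDomainType) (x : K) n : -1 <= x -> 1 + n%:R * x <= (1 + x) ^+ n.
Proof.
move=> x_ge; elim: n => [|n IHn]; first by rewrite mul0r addr0 expr0.
rewrite exprS; apply: le_trans (ler_wpM2l _ IHn); last lra.
rewrite -subr_ge0 -natr1.
have -> : (1 + x) * (1 + n%:R * x) - (1 + (n%:R + 1) * x) = n%:R * x ^+ 2 by ring.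
by rewrite mulr_ge0// sqr_ge0.
Qed.

(* The polynomials [(1 - x ^ N) ^ (k ^ N)] of the elementary proof of the
   Stone-Weierstrass theorem jump from 1 to 0 at [x = 1 / k]. *)
Definition stone_poly (k N : nat) : {poly R} := (1 - 'X^N) ^+ (k ^ N).

Lemma horner_stone_poly k N x : (stone_poly k N).[x] = (1 - x ^+ N) ^+ (k ^ N).
Proof. by rewrite horner_exp hornerD hornerN hornerC hornerXn. Qed.

Lemma stone_poly_itv k N x : 0 <= x <= 1 -> 0 <= (stone_poly k N).[x] <= 1.
Proof.
move=> /andP[x0 x1]; rewrite horner_stone_poly.
have xN0 : 0 <= x ^+ N by rewrite exprn_ge0.
have xN1 : x ^+ N <= 1 by rewrite exprn_ile1.
by rewrite exprn_ge0 ?exprn_ile1//; lra.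
Qed.

Lemma stone_poly_ge k N x : 0 <= x <= 1 ->
  1 - (k%:R * x) ^+ N <= (stone_poly k N).[x].
Proof.
move=> /andP[x0 x1]; rewrite horner_stone_poly.
have xN1 : - 1 <= - x ^+ N by rewrite lerN2 exprn_ile1.
by have := bernoulli_le (k ^ N) xN1; rewrite mulrN natrX -exprMn.
Qed.

Lemma stone_poly_le k N x : 0 <= x <= 1 -> 0 < k%:R * x ->
  (stone_poly k N).[x] <= (k%:R * x)^-1 ^+ N.
Proof.
move=> /andP[x0 x1] kx0; rewrite horner_stone_poly exprVn.
set y := x ^+ N; have y01 : 0 <= y <= 1 by rewrite exprn_ge0 ?exprn_ile1.
have kxN0 : 0 < (k%:R * x) ^+ N by rewrite exprn_gt0.
rewrite -(ler_pM2r kxN0) mulVf ?gt_eqF//.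
apply: le_trans (_ : (1 - y) ^+ (k ^ N) * (1 + y) ^+ (k ^ N) <= _).
  rewrite ler_wpM2l// ?exprn_ge0//; first lra.
  have y_ge : -1 <= y by lra.
  by apply: le_trans (bernoulli_le (k ^ N) y_ge); rewrite exprMn natrX -/y; lra.
rewrite -exprMn exprn_ile1//; last by nra.
by have : 0 <= y * y; nra.
Qed.

Lemma cvg_of_geometric_dist (u : nat -> R) (l r : R) : 0 <= r < 1 ->
  (forall N, `|u N - l| <= r ^+ N) -> u @ \oo --> l.
Proof.
move=> /andP[r0 r1] ur; apply/subr_cvg0/norm_cvg0P.
apply: squeeze_cvgr (cvg_cst 0) (@cvg_expr R r _); last by rewrite ger0_norm.
by apply: nearW => N; rewrite normr_ge0 /= ur.
Qed.

Lemma exists_step_poly (kappa : R) : 0 < kappa -> exists P : nat -> {poly R},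
  [/\ forall N x, 0 <= x <= 1 -> 0 <= (P N).[x] <= 1,
      forall x, 0 <= x < kappa -> x <= 1 -> (P N).[x] @[N --> \oo] --> (1 : R) &
      forall x, kappa < x <= 1 -> (P N).[x] @[N --> \oo] --> (0 : R)].
Proof.
move=> kappa0; pose k := Num.bound kappa^-1.
have k_gt : kappa^-1 < k%:R by apply: archi_boundP; rewrite invr_ge0 ltW.
have k0 : 0 < k%:R :> R by apply: lt_trans k_gt; rewrite invr_gt0.
have kkappa1 : 1 < k%:R * kappa by rewrite -ltr_pdivrMr// div1r.
have kkappa0 : 0 < k%:R * kappa by exact: lt_trans kkappa1.
pose c := (k%:R * kappa)^-1.
have c0 : 0 < c by rewrite invr_gt0.
have c1 : c <= 1 by rewrite invf_le1// ltW.
have cx01 (x : R) : 0 <= x <= 1 -> 0 <= c * x <= 1.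
  by move=> /andP[x0 x1]; rewrite mulr_ge0 ?mulr_ile1// ltW.
have kcx (x : R) : k%:R * (c * x) = x / kappa by rewrite /c; field; rewrite !gt_eqF.
exists (fun N => stone_poly k N \Po (c *: 'X)).
have hornerE N x : (stone_poly k N \Po (c *: 'X)).[x] = (stone_poly k N).[c * x].
  by rewrite horner_comp hornerZ hornerX.
split=> [N x x01|x /andP[x0 xkappa] x1|x /andP[kappax x1]].
- by rewrite hornerE; exact: stone_poly_itv (cx01 _ x01).
- have x01 : 0 <= c * x <= 1 by rewrite cx01 ?x0.
  apply: (cvg_of_geometric_dist (r := x / kappa)) => [|N].
    by rewrite divr_ge0 ?ltr_pdivrMr ?mul1r// ltW.
  have /andP[_ p1] := stone_poly_itv k N x01.
  rewrite hornerE distrC ger0_norm ?subr_ge0// -kcx lerBlDl -lerBlDr.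
  exact: stone_poly_ge.
- have x0 : 0 < x by exact: lt_trans kappax.
  have x01 : 0 <= c * x <= 1 by rewrite cx01// (ltW x0).
  apply: (cvg_of_geometric_dist (r := (x / kappa)^-1)) => [|N].
    by rewrite invr_ge0 divr_ge0 ?(ltW x0) ?(ltW kappa0)// invf_div ltr_pdivrMr// mul1r.
  have /andP[p0 _] := stone_poly_itv k N x01.
  by rewrite hornerE subr0 ger0_norm// -kcx stone_poly_le// kcx divr_gt0.
Qed.

End StepPolynomials.

Section CosineOnCircle.
Variable R : realType.

Lemma cos_lt_near (d x : R) : d <= pi -> `|x| < d -> cos d < cos x.
Proof.
move=> dpi xd; have d0 : 0 <= d by rewrite (le_trans _ (ltW xd)).
rewrite -(cos_norm x) ltr_cos// in_itv/= ?d0// normr_ge0.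
exact: le_trans (ltW xd) dpi.
Qed.

Lemma cos_lt_far (d x : R) : 0 <= d -> d < `|x| < 2 * pi - d -> cos x < cos d.
Proof.
move=> d0; rewrite -(cos_norm x); move: `|x| => y /andP[dy yd].
have [ypi|piy] := leP y pi; first by rewrite ltr_cos// in_itv/=; apply/andP; split; lra.
have -> : y = - (2 * pi - y) + pi *+ 2 by rewrite -(mulr_natl pi); ring.
by rewrite cosD2pi cosN ltr_cos ?in_itv/=; [lra|apply/andP; split; lra..].
Qed.

(* Within the circle, ]0, b[ is the arc where [arc_coord b] exceeds its value at 0. *)
Definition arc_coord (b t : R) : R := (1 + cos (t - b / 2)) / 2.

Lemma arc_coord_itv b t : 0 <= arc_coord b t <= 1.
Proof.
rewrite /arc_coord; have := cos_geN1 (t - b / 2); have := cos_le1 (t - b / 2).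
by move=> ? ?; apply/andP; split; lra.
Qed.

Lemma arc_coord0 b : arc_coord b 0 = (1 + cos (b / 2)) / 2.
Proof. by rewrite /arc_coord sub0r cosN. Qed.

Lemma arc_coord0_gt0 b : 0 < b < 2 * pi -> 0 < arc_coord b 0.
Proof.
move=> /andP[b0 b2pi]; have : cos pi < cos (b / 2).
  by rewrite ltr_cos ?in_itv/=; [lra|apply/andP; split; lra..].
by rewrite arc_coord0 cospi; lra.
Qed.

Lemma arc_coord_gt b t : b < 2 * pi -> 0 < t -> t < b -> arc_coord b 0 < arc_coord b t.
Proof.
move=> b2pi t0 tb; have : cos (b / 2) < cos (t - b / 2).
  by apply: cos_lt_near; [lra|rewrite ltr_norml; apply/andP; split; lra].
by rewrite arc_coord0 /arc_coord; lra.
Qed.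

Lemma arc_coord_lt b t : 0 < b -> b < t -> t < 2 * pi -> arc_coord b t < arc_coord b 0.
Proof.
move=> b0 bt t2pi; have : cos (t - b / 2) < cos (b / 2).
  by apply: cos_lt_far; rewrite ?ger0_norm; [lra|apply/andP; split; lra|lra].
by rewrite arc_coord0 /arc_coord; lra.
Qed.

Lemma is_trigpoly_horner_arc_coord (P : {poly R}) b :
  is_trigpoly (fun t => (P.[arc_coord b t])%:C).
Proof.
apply: is_trigpoly_horner.
have -> : (fun t => (arc_coord b t)%:C) =
    (fun t => ((2^-1 *: (1 + 'X)).[cos (t - b / 2)])%:C).
  by apply/funext => t; rewrite !hornerE mulrC.
by apply: is_trigpoly_horner; exact: is_trigpoly_cosB.
Qed.

End CosineOnCircle.

Section Density.
Variable R : realType.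
Local Notation C := R[i].
Local Notation mu := (@lebesgue_measure R).
Local Notation T := (@Tdom R).
Implicit Types (f g p : R -> C) (u v : R -> R) (A : set (measurableTypeR R)).

Definition trig_limit f := forall e : R, 0 < e ->
  exists2 p, is_trigpoly p & (L2sq (fun t => (f t - p t)%R) <= e%:E)%E.

Lemma trigpoly_trig_limit p : is_trigpoly p -> trig_limit p.
Proof.
move=> tp e e0; exists p => //; rewrite /L2sq.
under eq_integral do rewrite subrr normc0 expr0n.
by rewrite integral0 lee_fin ltW.
Qed.

Lemma trig_limit_cst (c : C) : trig_limit (fun=> c).
Proof. exact/trigpoly_trig_limit/is_trigpoly_cst. Qed.

Lemma trig_limit_closed f : cmeasurable f ->
  (forall e : R, 0 < e -> exists g, [/\ trig_limit g, cmeasurable g &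
    (L2sq (fun t => (f t - g t)%R) <= e%:E)%E]) -> trig_limit f.
Proof.
move=> mf flim e e0; have e4 : 0 < e / 4 by rewrite divr_gt0.
have [g [glim mg fg]] := flim _ e4; have [p tp gp] := glim _ e4.
exists p => //; have [mp _] := is_trigpoly_inL2 tp.
have -> : (fun t => f t - p t) = (fun t => (f t - g t) + (g t - p t)).
  by apply/funext => t; rewrite addrA subrK.
by apply: L2sqD_le_small => //; exact: cmeasurableB.
Qed.

Lemma ae_eq_trig_limit f g : cmeasurable f -> cmeasurable g ->
  {ae mu, forall t, T t -> f t = g t} -> trig_limit g -> trig_limit f.
Proof.
move=> mf mg fg glim; apply: trig_limit_closed => // e e0; exists g; split => //.
apply: le_trans (_ : _ <= (0 ^+ 2)%:E * L2sq g)%E _; last by rewrite expr0n mul0e lee_fin ltW.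
apply: ae_L2sq_le => //; first exact: cmeasurableB.
by apply: filterS fg => t fg Tt; rewrite fg// subrr normc0 mul0r.
Qed.

Lemma trig_limitD f g : cmeasurable f -> cmeasurable g ->
  trig_limit f -> trig_limit g -> trig_limit (fun t => f t + g t).
Proof.
move=> mf mg flim glim e e0; have e4 : 0 < e / 4 by rewrite divr_gt0.
have [p tp fp] := flim _ e4; have [q tq gq] := glim _ e4.
have [[mp _] [mq _]] := (is_trigpoly_inL2 tp, is_trigpoly_inL2 tq).
exists (fun t => p t + q t); first exact: is_trigpolyD.
under eq_fun do rewrite opprD addrACA.
by apply: L2sqD_le_small => //; exact: cmeasurableB.
Qed.

Lemma trig_limitZ (c : C) f : cmeasurable f ->
  trig_limit f -> trig_limit (fun t => c * f t).
Proof.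
move=> mf flim e e0; have c1 : 0 < normc c ^+ 2 + 1 by rewrite ltr_wpDl// sqr_ge0.
have [p tp fp] := flim _ (divr_gt0 e0 c1); have [mp _] := is_trigpoly_inL2 tp.
exists (fun t => c * p t); first by apply: is_trigpolyM => //; exact: is_trigpoly_cst.
under eq_fun do rewrite -mulrBr.
have mfp := cmeasurableB mf mp.
apply: le_trans (ae_L2sq_le (normc_ge0 c) (cmeasurableMl c mfp) mfp _) _.
  by apply: aeW => t _; rewrite normcM.
apply: le_trans (lee_wpmul2l _ fp) _; first by rewrite lee_fin sqr_ge0.
by rewrite -EFinM lee_fin mulrA ler_pdivrMr// mulrDr mulr1 mulrC lerDl ltW.
Qed.

Lemma trig_limitB f g : cmeasurable f -> cmeasurable g ->
  trig_limit f -> trig_limit g -> trig_limit (fun t => f t - g t).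
Proof.
move=> mf mg flim glim; under eq_fun do rewrite -mulN1r.
by apply: trig_limitD => //; [exact: cmeasurableMl|exact: trig_limitZ].
Qed.

Lemma trig_limit_sum I (s : seq I) (F : I -> R -> C) :
  (forall i, cmeasurable (F i)) -> (forall i, trig_limit (F i)) ->
  trig_limit (fun t => \sum_(i <- s) F i t).
Proof.
move=> mF Flim; elim: s => [|i s IHs].
  by under eq_fun do rewrite big_nil; exact: trig_limit_cst.
under eq_fun do rewrite big_cons.
by apply: trig_limitD => //; exact: cmeasurable_sum.
Qed.

Lemma trig_limit_dominated (v_ : nat -> R -> R) u (G : R -> R) :
  measurable_fun T u -> (forall n, measurable_fun T (v_ n)) ->
  (forall n, trig_limit (fun t => (v_ n t)%:C)) ->
  {ae mu, forall t, T t -> v_ n t @[n --> \oo] --> u t} ->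
  mu.-integrable T (EFin \o fun t => G t ^+ 2) ->
  (forall n t, T t -> `|v_ n t - u t| <= G t) -> trig_limit (fun t => (u t)%:C).
Proof.
move=> u_meas mv vlim vu iG vuG.
have mdist n : measurable_fun T (fun t => (normc ((u t)%:C - (v_ n t)%:C) ^+ 2)%:E).
  by apply: measurable_EFin_normcX; apply: cmeasurableB; exact: cmeasurable_real.
have distE n t : normc ((u t)%:C - (v_ n t)%:C) ^+ 2 = (v_ n t - u t) ^+ 2.
  by rewrite -rmorphB normc_real real_normK ?num_real// -sqrrN opprB.
have [||_ _] := dominated_convergence (measurable_Tdom R) mdist (measurable_cst 0%E) _ iG.
- apply: filterS vu => t vut Tt; apply/fine_cvgP; split; first exact: nearW.
  under eq_fun do rewrite /= distE expr2.
  have /subr_cvg0 vu0 := vut Tt; have := cvgM vu0 vu0; rewrite mulr0; exact.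
- apply: aeW => t n Tt; rewrite abse_EFin lee_fin distE ger0_norm ?sqr_ge0//.
  by rewrite -ler_sqrt ?sqr_ge0// !sqrtr_sqr (le_trans (vuG _ _ Tt))// ler_norm.
rewrite integral0 => /fine_cvgP[fin_dist /cvgrPdist_lt dist0].
apply: trig_limit_closed; first exact: cmeasurable_real.
move=> e e0; have [N _ /(_ N (leqnn N))[fin_distN]] := filterI fin_dist (dist0 e e0).
rewrite sub0r normrN /= => distN.
exists (fun t => (v_ N t)%:C); split => //; first exact: cmeasurable_real.
by rewrite /L2sq -[leLHS]fineK// lee_fin (le_trans (ler_norm _))// ltW.
Qed.

Lemma cmeasurable_indic A : measurable A -> cmeasurable (fun t => (\1_A t)%:C : C).
Proof. by move=> mA; apply: cmeasurable_real; exact: measurable_indic. Qed.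

Lemma trig_limit_arc (b : R) : 0 < b < 2 * pi ->
  trig_limit (fun t => (\1_(`]-oo, b[%classic) t)%:C).
Proof.
move=> b_itv; have /andP[b0 b2pi] := b_itv; have s01 := arc_coord_itv b.
have [P [P01 Pcvg1 Pcvg0]] := exists_step_poly (arc_coord0_gt0 b_itv).
have tP N : is_trigpoly (fun t => (1 - (P N).[arc_coord b t])%:C).
  have := is_trigpoly_horner_arc_coord (1 - P N) b.
  by under eq_fun do rewrite hornerD hornerN hornerC.
apply: (trig_limit_dominated (v_ := fun N t => 1 - (P N).[arc_coord b t]) (G := cst 1)).
- exact: measurable_indic.
- by move=> N; have [[mRe _] _] := is_trigpoly_inL2 (tP N).
- by move=> N; exact: (trigpoly_trig_limit (tP N)).
- apply: filterS3 (ae_neq (0 : R)) (ae_neq (2 * pi : R)) (ae_neq b).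
  move=> t /eqP t0 /eqP t2pi /eqP tb.
  rewrite /Tdom /= in_itv/= => /andP[t_ge0 t_le2pi].
  have {t0 t_ge0}t_gt0 : 0 < t by rewrite lt_neqAle eq_sym t0.
  have {t2pi t_le2pi}t_lt2pi : t < 2 * pi by rewrite lt_neqAle t2pi.
  have /andP[s_ge0 s_le1] := s01 t; have [{}tb|bt] := ltP t b.
    rewrite indicE mem_set ?in_itv//= -[X in _ --> X]subr0.
    by apply: cvgB (cvg_cst _) _; apply: Pcvg0; rewrite arc_coord_gt.
  have {tb}bt : b < t by rewrite lt_neqAle eq_sym tb.
  rewrite indicE memNset/= ?in_itv/=; last by apply/negP; rewrite -leNgt ltW.
  rewrite -[X in _ --> X](subrr 1); apply: cvgB (cvg_cst _) _.
  by apply: Pcvg1 => //; rewrite s_ge0 arc_coord_lt.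
- exact: (integrable_Tdom_cst (1 ^+ 2)).
- move=> N t _; have /andP[p0 p1] := P01 N _ (s01 t).
  by rewrite indicE; case: (_ \in _); rewrite /= ler_norml; apply/andP; split; lra.
Qed.

Lemma trig_limit_ray (b : R) : trig_limit (fun t => (\1_(`]-oo, b[%classic) t)%:C).
Proof.
have mb := cmeasurable_indic (measurable_itv `]-oo, b[).
have [b0|b0] := leP b 0.
  apply: (ae_eq_trig_limit mb (cmeasurable_cst 0) _ (trig_limit_cst 0)).
  apply: aeW => t; rewrite /Tdom /= in_itv/= => /andP[t0 _].
  by rewrite indicE memNset//= in_itv/=; apply/negP; rewrite -leNgt; lra.
have [b2|b2] := leP (2 * pi) b; last by apply: trig_limit_arc; rewrite b0.
apply: (ae_eq_trig_limit mb (cmeasurable_cst 1) _ (trig_limit_cst 1)).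
apply: filterS (ae_neq (2 * pi : R)) => t /eqP t2pi.
rewrite /Tdom /= in_itv/= => /andP[_ t_le]; rewrite indicE mem_set//= in_itv/=.
by rewrite (lt_le_trans _ b2)// lt_neqAle t2pi.
Qed.

Lemma cvg_indic_bigcup (F : nat -> set R) (t : R) : nondecreasing_seq F ->
  \1_(F n) t @[n --> \oo] --> (\1_(\bigcup_n F n) t : R).
Proof.
move=> ndF; apply: cvg_near_cst; have [[N _ FNt]|Ft] := pselect ((\bigcup_n F n) t).
  exists N => // n /= Nn; rewrite !indicE !mem_set//; first by exists N.
  by have /subsetPset := ndF _ _ Nn; exact.
by apply: nearW => n; rewrite !indicE !memNset// => Fnt; apply: Ft; exists n.
Qed.

Lemma trig_limit_indic A : measurable A -> trig_limit (fun t => (\1_A t)%:C).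
Proof.
pose rays := [set B : set (measurableTypeR R) | exists b, B = `]-oo, b[%classic].
have measurableE : (@measurable _ (measurableTypeR R)) = <<s rays >>.
  exact: RGenInftyO.measurableE.
suff sub : <<s rays >> `<=` [set B | measurable B /\ trig_limit (fun t => (\1_B t)%:C)].
  by rewrite measurableE => /sub[].
apply: lambda_system_subset => //.
- move=> _ _ [a ->] [b ->]; exists (Order.min a b).
  by apply/seteqP; split => t /=; rewrite !in_itv/= lt_min => /andP.
- split=> //.
  + by split => //; rewrite indicT; exact: (trig_limit_cst 1).
  + move=> B D DB [mB Blim] [mD Dlim]; split; first exact: measurableD.
    have -> : (fun t => (\1_(B `\` D) t)%:C) = (fun t => (\1_B t)%:C - (\1_D t)%:C :> C).
      apply/funext => t; rewrite -rmorphB; congr (_%:C); rewrite !indicE in_setD.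
      have [/set_mem/DB/mem_set ->|_] := boolP (t \in D); last by rewrite andbT subr0.
      by rewrite andbF subrr.
    by apply: trig_limitB => //; exact: cmeasurable_indic.
  + move=> F ndF Flim; have mF n : measurable (F n) by case: (Flim n).
    have mUF : measurable (\bigcup_n F n) by exact: bigcup_measurable.
    split => //; apply: (trig_limit_dominated (v_ := fun n => \1_(F n)) (G := cst 1)).
    * exact: measurable_indic.
    * by move=> n; apply: measurable_indic; exact: mF.
    * by move=> n; case: (Flim n).
    * by apply: aeW => t _; exact: cvg_indic_bigcup.
    * exact: (integrable_Tdom_cst (1 ^+ 2)).
    * move=> n t _; rewrite !indicE.
      by do 2 case: (_ \in _); rewrite /= ?subrr ?subr0 ?sub0r ?normrN ?normr0 ?normr1.
- move=> _ [b ->]; split; first exact: measurable_itv.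
  exact: trig_limit_ray.
Qed.

Import HBNNSimple.

Lemma trig_limit_nnsfun (v : {nnsfun measurableTypeR R >-> R}) :
  trig_limit (fun t => (v t)%:C).
Proof.
under eq_fun do rewrite fimfunEord rmorph_sum.
have mv y : measurable (v @^-1` [set y] : set (measurableTypeR R)).
  exact: measurable_sfunP.
apply: trig_limit_sum => i; under eq_fun do rewrite rmorphM.
  by apply: cmeasurableMl; exact: cmeasurable_indic.
by apply: trig_limitZ; [exact: cmeasurable_indic|exact: trig_limit_indic].
Qed.

Lemma trig_limit_ge0 u : measurable_fun T u -> (forall t, 0 <= u t) ->
  mu.-integrable T (EFin \o fun t => u t ^+ 2) -> trig_limit (fun t => (u t)%:C).
Proof.
move=> u_meas u0 iu; have mEu : measurable_fun (T : set (measurableTypeR R)) (EFin \o u).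
  exact/measurable_EFinP.
have u0E (t : measurableTypeR R) : T t -> (0 <= (EFin \o u) t)%E by rewrite lee_fin.
pose v := nnsfun_approx (measurable_Tdom R) mEu.
apply: (trig_limit_dominated (v_ := v) (G := u)) => // [n|n||n t Tt].
- exact: (measurable_funS measurableT (@subsetT _ T) (measurable_funPT (v n))).
- exact: trig_limit_nnsfun.
- apply: aeW => t Tt; have /fine_cvgP[_] := cvg_nnsfun_approx (measurable_Tdom R) mEu u0E Tt.
  exact.
- have vu : v n t <= u t.
    by rewrite -lee_fin /v nnsfun_approxE; exact: (le_approx n u0E Tt).
  by rewrite distrC ger0_norm ?subr_ge0// lerBlDr lerDl.
Qed.

Lemma trig_limit_real u : measurable_fun T u ->
  mu.-integrable T (EFin \o fun t => u t ^+ 2) -> trig_limit (fun t => (u t)%:C).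
Proof.
move=> u_meas iu; have mup := measurable_funrpos u_meas; have mun := measurable_funrneg u_meas.
have -> : (fun t => (u t)%:C) = (fun t => (u^\+ t)%:C - (u^\- t)%:C :> C).
  by apply/funext => t; rewrite -rmorphB -[in LHS](funrposBneg u).
have u_posneg t : `|u t| = u^\+ t + u^\- t by have /(congr1 (@^~ t)) := funrposDneg u.
apply: trig_limitB; [exact: cmeasurable_real|exact: cmeasurable_real| |].
- apply: trig_limit_ge0 => //; apply: (le_integrable_sqr (measurable_Tdom R) mup _ iu) => t.
  by rewrite u_posneg ger0_norm// lerDl.
- apply: trig_limit_ge0 => //; apply: (le_integrable_sqr (measurable_Tdom R) mun _ iu) => t.
  by rewrite u_posneg ger0_norm// lerDr.
Qed.

Theorem inL2_trig_limit f : inL 2 f -> trig_limit f.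
Proof.
move=> fL2; have i_f := inL2_integrable fL2; have [[mRe mIm] _] := fL2.
have iRe : mu.-integrable T (EFin \o fun t => Re (f t) ^+ 2).
  apply: (le_integrable_sqr (measurable_Tdom R) mRe _ i_f) => t.
  by rewrite [leRHS]ger0_norm ?normc_ge0// normr_Re_le.
have iIm : mu.-integrable T (EFin \o fun t => Im (f t) ^+ 2).
  apply: (le_integrable_sqr (measurable_Tdom R) mIm _ i_f) => t.
  by rewrite [leRHS]ger0_norm ?normc_ge0// normr_Im_le.
rewrite (_ : f = (fun t => (Re (f t))%:C + 'i * (Im (f t))%:C)); last first.
  by apply/funext => t; rewrite -complexE.
have cRe := cmeasurable_real mRe; have cIm := cmeasurable_real mIm.
apply: trig_limitD => //; [exact: cmeasurableMl|exact: trig_limit_real|].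
by apply: trig_limitZ => //; exact: trig_limit_real.
Qed.

End Density.

Section SquareIntegrableAnalytic.
Variable R : realType.
Local Notation C := R[i].
Local Notation mu := (@lebesgue_measure R).
Local Notation T := (@Tdom R).
Implicit Types (f k : R -> C) (s : seq (int * C)).

Lemma fourier_eq0_ae f : inL 2 f -> (forall m, fourier f m = 0) ->
  {ae mu, forall t, T t -> f t = 0}.
Proof.
move=> fL2 f0; apply: (L2sq_eq0_ae fL2).
have fL1 := inL2_cintegrable fL2.
have orth s : cint (fun t => f t * (trigpoly s t)^*) = 0.
  under eq_fun do rewrite conjc_trigpoly.
  by rewrite cint_mul_trigpoly// big1 => // x _; rewrite f0 mul0r.
apply/eqP; rewrite eq_le L2sq_ge0 andbT; apply/lee_addgt0Pr => e e0; rewrite add0e.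
have [p [s /funext ->] fs] := inL2_trig_limit fL2 e0; apply: le_trans fs.
by rewrite (L2sqB_orthogonal fL2 (inL2_trigpoly s) (orth s)) leeDl// L2sq_ge0.
Qed.

(* By orthogonality the analytic part of a trigonometric approximant of an analytic
   function is at least as good as the approximant itself. *)
Lemma analytic_trig_limit f : inL 2 f -> analytic_coeffs f -> forall e : R, 0 < e ->
  exists2 s, all (fun x => 0 <= x.1) s & (L2sq (fun t => (f t - trigpoly s t)%R) <= e%:E)%E.
Proof.
move=> fL2 af e e0; have [p [s /funext ->] fs] := inL2_trig_limit fL2 e0.
pose sP := [seq x <- s | 0 <= x.1]; pose sN := [seq x <- s | ~~ (0 <= x.1)].
have sPL2 := inL2_trigpoly sP.
exists sP; first exact: filter_all.
have fsPL2 := inL2B fL2 sPL2.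
have orth : cint (fun t => (f t - trigpoly sP t) * (trigpoly sN t)^*) = 0.
  under eq_fun do rewrite conjc_trigpoly.
  rewrite cint_mul_trigpoly; last exact: inL2_cintegrable.
  rewrite big_map big1_seq// => x /andP[_]; rewrite mem_filter -ltNge => /andP[x0 _].
  rewrite opprK fourierB; [|exact: inL2_cintegrable..].
  by rewrite af// (analytic_trigpoly (filter_all _ _))// subrr mul0r.
apply: le_trans fs.
rewrite (_ : (fun t => f t - trigpoly s t) =
    (fun t => f t - trigpoly sP t - trigpoly sN t)); last first.
  apply/funext => t; rewrite -addrA -opprD /trigpoly !big_filter.
  by rewrite [in LHS](bigID (fun x => 0 <= x.1)).
by rewrite (L2sqB_orthogonal fsPL2 (inL2_trigpoly sN) orth) leeDl// L2sq_ge0.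
Qed.

Lemma analytic_coeffsM k f : inL 2 k -> analytic_coeffs k -> inL 2 f -> analytic_coeffs f ->
  analytic_coeffs (fun t => k t * f t).
Proof.
move=> kL2 ak fL2 af m m0; rewrite fourierE.
have kL1 := inL2_cintegrable kL2; have kfL1 := inL2M_cintegrable kL2 fL2.
apply: (cint_eq0_of_small kL2) => e e0.
have [s s_ge0 fs] := analytic_trig_limit fL2 af e0.
have fsL2 := inL2B fL2 (inL2_trigpoly s).
exists (fun t => cexp (- m) t * (f t - trigpoly s t)); split.
- by apply: inL2Ml => //; exact: inLinf_cexp.
- rewrite (_ : L2sq _ = L2sq (fun t => (f t - trigpoly s t)%R))//.
  by apply: eq_integral => t _; rewrite normcM normc_cexp mul1r.
have -> : (fun t => k t * (cexp (- m) t * (f t - trigpoly s t))) =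
    (fun t => k t * f t * cexp (- m) t - k t * cexp (- m) t * trigpoly s t).
  by apply/funext => t; ring.
have kexpL1 := cintegrableM_cexp (- m) kL1.
rewrite cintB; [|exact: cintegrableM_cexp|]; last first.
  by apply: cintegrableMr_bounded kexpL1 _ (fun t _ => normc_trigpoly_le s t);
    case: (inL2_trigpoly s).
rewrite [X in _ - X]cint_mul_trigpoly// big1_seq ?subr0// => x /andP[_ xs].
rewrite fourierM_cexp opprK ak ?mul0r// addrC ltr_wnDr// oppr_le0.
exact: (allP s_ge0).
Qed.

End SquareIntegrableAnalytic.

Section Multipliers.
Variable R : realType.
Local Notation C := R[i].
Implicit Types f g : R -> C.

(* These are the bounded analytic functions of mean 1, described through their action
   on H^1 so that products need no separate argument. *)
Definition normalized_multiplier g :=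
  [/\ cmeasurable g, exists M, forall t, normc (g t) <= M &
    forall f, cintegrable f -> analytic_coeffs f ->
      analytic_coeffs (fun t => f t * g t) /\ fourier (fun t => f t * g t) 0 = fourier f 0].

Lemma cintegrableM_multiplier f g : cintegrable f -> normalized_multiplier g ->
  cintegrable (fun t => f t * g t).
Proof. by move=> fL1 [mg [M gM] _]; exact: (cintegrableMr_bounded fL1 mg (M := M)). Qed.

Lemma normalized_multiplier1 : normalized_multiplier (fun=> 1).
Proof.
split; [exact: cmeasurable_cst|by exists (normc (1 : C))|].
by move=> f _ af; under eq_fun do rewrite mulr1.
Qed.

Lemma normalized_multiplierM g h : normalized_multiplier g -> normalized_multiplier h ->
  normalized_multiplier (fun t => g t * h t).
Proof.
move=> gmult hmult; have [[mg [M gM] gact] [mh [N hN] hact]] := (gmult, hmult).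
split; first exact: cmeasurableM.
  by exists (M * N) => t; rewrite normcM ler_pM ?normc_ge0.
move=> f fL1 af; have [afg <-] := gact f fL1 af.
have := hact _ (cintegrableM_multiplier fL1 gmult) afg.
by under eq_fun do rewrite -mulrA.
Qed.

Lemma normalized_multiplierX g n : normalized_multiplier g ->
  normalized_multiplier (fun t => g t ^+ n).
Proof.
move=> gmult; elim: n => [|n IHn].
  by under eq_fun do rewrite expr0; exact: normalized_multiplier1.
by under eq_fun do rewrite exprS; exact: normalized_multiplierM.
Qed.

Lemma fourierM_1subZexp f (b : C) (m : int) : cintegrable f ->
  fourier (fun t => f t * (1 - b * cexp 1 t)) m = fourier f m - fourier f (m - 1) * b.
Proof.
move=> fL1; have fexpL1 := cintegrableM_cexp 1 fL1.
rewrite -(fourierM_cexp f m 1) -fourierZr// -fourierB//; last exact: cintegrableZr.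
by under eq_fun do rewrite mulrBr mulr1 mulrCA mulrC.
Qed.

Lemma cmeasurable_1subZexp (b : C) : cmeasurable (fun t : R => 1 - b * cexp 1 t).
Proof.
apply: cmeasurableB; first exact: cmeasurable_cst.
by apply: cmeasurableMl; exact: cmeasurable_cexp.
Qed.

Lemma normalized_multiplier_1subZexp (b : C) :
  normalized_multiplier (fun t => 1 - b * cexp 1 t).
Proof.
split; first exact: cmeasurable_1subZexp.
  exists (1 + normc b) => t; apply: le_trans (le_normcD _ _) _.
  by rewrite normcN normcM normc_cexp mulr1 normc1.
move=> f fL1 af; split=> [m m0|]; rewrite fourierM_1subZexp//.
  by rewrite !af ?mul0r ?subrr// ltrBlDr (lt_trans m0).
by rewrite (af (0 - 1)) ?mul0r ?subr0.
Qed.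

Lemma geometric_bound_eq0 (x : C) (r M : R) : 0 <= r < 1 ->
  (forall n : nat, normc x <= r ^+ n * M) -> x = 0.
Proof.
move=> /andP[r0 r1] xr; apply: eq0_normc; apply/eqP.
rewrite eq_le normc_ge0 andbT.
have rM : r ^+ n * M @[n --> \oo] --> (0 * M : R).
  by apply: cvgM (cvg_cst M); apply: cvg_expr; rewrite ger0_norm.
by rewrite mul0r in rM; apply: cvgr_to_ge rM _; exact: nearW.
Qed.

Lemma backward_geometric_eq0 (h : int -> C) (b : C) (M : R) : normc b < 1 ->
  (forall m, normc (h m) <= M) -> (forall m, m < 0 -> h m = h (m - 1) * b) ->
  forall m, m < 0 -> h m = 0.
Proof.
move=> b1 hM h_rec m m0; apply: (@geometric_bound_eq0 _ (normc b) M) => [|n].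
  by rewrite normc_ge0.
elim: n m m0 => [|n IHn] m m0; first by rewrite mul1r.
rewrite h_rec// normcM mulrC exprS -mulrA ler_wpM2l ?normc_ge0// IHn//.
by rewrite ltrBlDr (lt_trans m0).
Qed.

Lemma normc_1subZexp_ge (b : C) (t : R) : 1 - normc b <= normc (1 - b * cexp 1 t).
Proof.
have := le_normcD (1 - b * cexp 1 t) (b * cexp 1 t).
by rewrite subrK normcM normc_cexp mulr1 normc1 lerBlDr.
Qed.

(* If [f = h (1 - b z)] with f analytic, then the negative coefficients of h satisfy
   the recurrence of [backward_geometric_eq0]. *)
Lemma normalized_multiplier_inv1subZexp (b : C) : normc b < 1 ->
  normalized_multiplier (fun t => (1 - b * cexp 1 t)^-1).
Proof.
move=> b1; have den_neq0 (t : R) : 1 - b * cexp 1 t != 0.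
  apply: contraTneq (normc_1subZexp_ge b t) => ->.
  by rewrite normc0 -ltNge subr_gt0.
have minv := cmeasurableV (cmeasurable_1subZexp b).
have inv_le (t : R) : normc (1 - b * cexp 1 t)^-1 <= (1 - normc b)^-1.
  rewrite normcV lef_pV2 ?normc_1subZexp_ge// posrE ?subr_gt0//.
  by rewrite (lt_le_trans _ (normc_1subZexp_ge b t))// subr_gt0.
split=> //; first by exists (1 - normc b)^-1.
move=> f fL1 af; set h := (fun t => f t * _).
have hL1 : cintegrable h by exact: (cintegrableMr_bounded fL1 minv (M := (1 - normc b)^-1)).
have fourier_rec m : fourier f m = fourier h m - fourier h (m - 1) * b.
  rewrite -fourierM_1subZexp//; congr (fourier _ m).
  by apply/funext => t; rewrite /h mulfVK.
have ah : analytic_coeffs h.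
  apply: (backward_geometric_eq0 b1 (fun m => normc_fourier_le m hL1)) => m m0.
  by have /esym/eqP := fourier_rec m; rewrite af// subr_eq0 => /eqP.
by split => //; rewrite fourier_rec (ah (0 - 1)) ?mul0r ?subr0.
Qed.

Lemma cexpB_arg (m : int) (t s : R) : cexp m (t - s) = cexp m t * cexp (- m) s.
Proof.
apply: complex_ext; rewrite ?ReM ?ImM /= mulrBr rmorphN /= mulNr cosN sinN.
  by rewrite cosB; ring.
by rewrite sinB; ring.
Qed.

Lemma sqr_normc_1subZexp (a t : R) :
  normc (1 - a%:C * cexp 1 t) ^+ 2 = 1 - 2 * a * cos t + a ^+ 2.
Proof.
rewrite sqr_normc_ReIm /= mul1r !mul0r subr0 addr0 add0r.
by have := cos2Dsin2 t; nra.
Qed.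

Lemma exists_expr_le (K : archiRealFieldType) (r e : K) : 0 <= r < 1 -> 0 < e ->
  exists n : nat, r ^+ n <= e.
Proof.
move=> /andP[r0 r1] e0; have : r ^+ n @[n --> \oo] --> 0.
  by apply: cvg_expr; rewrite ger0_norm.
move=> /cvgrPdist_le/(_ e e0)[n _ /(_ n (leqnn n))].
by rewrite sub0r normrN => /(le_trans (ler_norm _)); exists n.
Qed.

(* The arc on which [(1 - rho^2 z) / (1 - rho z)] may exceed 1 shrinks to [z = 1] as
   rho tends to 1. *)
Lemma sqr_normc_peak_quotient_le (rho kappa t : R) : 0 <= rho <= 1 -> cos t <= kappa ->
  0 <= rho * (1 + rho) - 2 * kappa ->
  normc (1 - (rho ^+ 2)%:C * cexp 1 t) ^+ 2 <=
  (1 - rho * (1 - rho) * (rho * (1 + rho) - 2 * kappa) / 4)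
  * normc (1 - rho%:C * cexp 1 t) ^+ 2.
Proof.
move=> /andP[rho0 rho1] ct gap0; set d := rho * _ * _.
have d0 : 0 <= d by rewrite !mulr_ge0// subr_ge0.
have num_le : normc (1 - (rho ^+ 2)%:C * cexp 1 t) ^+ 2 <=
    normc (1 - rho%:C * cexp 1 t) ^+ 2 - d.
  have := ler_wpM2l (mulr_ge0 rho0 (_ : 0 <= 1 - rho)) ct.
  by rewrite !sqr_normc_1subZexp /d subr_ge0 => /(_ rho1); lra.
have den_le : normc (1 - rho%:C * cexp 1 t) ^+ 2 <= 4.
  by rewrite sqr_normc_1subZexp; have := cos_geN1 t; have := cos_le1 t; nra.
by apply: le_trans num_le _; nra.
Qed.

Lemma exists_peak_multiplier (t0 kappa eta : R) : 0 <= kappa < 1 -> 0 < eta ->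
  exists2 g, normalized_multiplier g & forall t, cos (t - t0) <= kappa -> normc (g t) <= eta.
Proof.
move=> /andP[k0 k1] eta0; pose rho : R := (1 + kappa) / 2.
have [rho0 rho1] : 0 < rho /\ rho < 1 by rewrite /rho; lra.
have gap0 : 0 < rho * (1 + rho) - 2 * kappa.
  rewrite [X in _ - 2 * X](_ : kappa = 2 * rho - 1); last by rewrite /rho; field.
  by nra.
pose theta := 1 - rho * (1 - rho) * (rho * (1 + rho) - 2 * kappa) / 4.
have theta01 : 0 <= theta < 1.
  rewrite /theta; set gap := _ - 2 * kappa in gap0 *.
  have gap2 : gap <= 2 by rewrite /gap; nra.
  have [c0 c1] : 0 < rho * (1 - rho) /\ rho * (1 - rho) <= 1 by split; nra.
  by apply/andP; split; nra.
have [L thetaL] := exists_expr_le theta01 (exprn_gt0 2 eta0).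
pose a := (rho ^+ 2)%:C * cexp (- 1) t0; pose b := rho%:C * cexp (- 1) t0.
have shift_arg (c t : R) : c%:C * cexp (- 1) t0 * cexp 1 t = c%:C * cexp 1 (t - t0).
  by rewrite cexpB_arg mulrAC mulrA.
have normb : normc b < 1.
  by rewrite normcM normc_cexp mulr1 normc_real ger0_norm// ltW.
exists (fun t => ((1 - a * cexp 1 t) * (1 - b * cexp 1 t)^-1) ^+ L).
  apply: normalized_multiplierX; apply: normalized_multiplierM.
    exact: normalized_multiplier_1subZexp.
  exact: normalized_multiplier_inv1subZexp.
move=> t ct; have den0 : 0 < normc (1 - b * cexp 1 t).
  by apply: lt_le_trans (normc_1subZexp_ge b t); rewrite subr_gt0.
rewrite -ler_sqr ?nnegrE ?normc_ge0 ?(ltW eta0)// normcX exprAC.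
apply: le_trans thetaL; apply: lerXn2r; rewrite ?nnegrE ?sqr_ge0//.
  by case/andP: theta01.
rewrite normcM normcV exprMn exprVn.
rewrite ler_pdivrMr ?exprn_gt0// !shift_arg; apply: sqr_normc_peak_quotient_le => //.
  by rewrite !ltW.
exact: ltW.
Qed.

End Multipliers.

Section AnnihilatingWeights.
Variable R : realType.
Local Notation C := R[i].
Local Notation mu := (@lebesgue_measure R).
Local Notation T := (@Tdom R).
Implicit Types (f g : R -> C) (w : R -> R).

Definition annihilating_weight w := measurable_fun T w /\
  forall f, inL 2 f -> analytic_coeffs f -> cintegrable (fun t => (w t)%:C * f t) ->
  {ae mu, forall t, T t -> f t = 0}.

Definition peak_weight (t0 : R) w := forall k : nat, exists2 g, normalized_multiplier g &
  forall t, T t -> t <> t0 -> k.+1%:R * normc (g t) <= 1 + w t.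

Definition disjoint_supports (I : eqType) (w : I -> R -> R) :=
  forall i j t, i != j -> w i t = 0 \/ w j t = 0.

Lemma natmul_bounded_le0 (K : archiRealFieldType) (x M : K) :
  (forall k : nat, k.+1%:R * x <= M) -> x <= 0.
Proof.
move=> xM; rewrite leNgt; apply/negP => x0.
have M0 : 0 <= M by rewrite (le_trans _ (xM 0%N))// mulr_ge0// ltW.
have := archi_boundP (divr_ge0 M0 (ltW x0)); rewrite ltr_pdivrMr// => Mx.
suff : M < M by rewrite ltxx.
apply: lt_le_trans Mx (le_trans _ (xM (Num.bound (M / x)))).
by apply: ler_wpM2r; [exact: ltW|rewrite ler_nat].
Qed.

Lemma peak_weight_fourier0_eq0 (t0 : R) w f : peak_weight t0 w ->
  cintegrable f -> analytic_coeffs f -> cintegrable (fun t => (w t)%:C * f t) ->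
  fourier f 0 = 0.
Proof.
move=> wpeak fL1 af wfL1; apply: eq0_normc; apply/eqP.
rewrite eq_le normc_ge0 andbT.
have i_f := integrable_normc fL1; have iwf := integrable_normc wfL1.
apply: (natmul_bounded_le0 (M := \int[mu]_(t in T) (normc (f t) + normc ((w t)%:C * f t)))).
move=> k; have [g gmult gk] := wpeak k; have [_ _ /(_ f fL1 af)[_ <-]] := gmult.
have fgL1 := cintegrableM_multiplier fL1 gmult; have ifg := integrable_normc fgL1.
apply: le_trans (ler_wpM2l (ler0n _ _) (normc_fourier_le 0 fgL1)) _.
rewrite mulrC -RintegralZr//; apply: ae_ge0_le_Rintegral => //.
- exact: integrable_EFinMr.
- exact: (integrableD (measurable_Tdom R) i_f iwf).
- by move=> t; rewrite mulr_ge0 ?normc_ge0.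
- by move=> t; rewrite addr_ge0 ?normc_ge0.
- apply: filterS (ae_neq t0) => t tt0 Tt.
  rewrite !normcM normc_real.
  apply: le_trans (_ : (1 + w t) * normc (f t) <= _).
    by rewrite -mulrA mulrC ler_wpM2r ?normc_ge0// mulrC gk.
  by rewrite mulrDl mul1r lerD2l ler_wpM2r ?normc_ge0 ?ler_norm.
Qed.

Lemma peak_weight_annihilating (t0 : R) w : measurable_fun T w -> peak_weight t0 w ->
  annihilating_weight w.
Proof.
move=> mw wpeak; split => // f fL2 af wfL1; have fL1 := inL2_cintegrable fL2.
(* Dividing by z moves the next coefficient to index 0. *)
have f_lt (n : nat) (m : int) : m < n%:Z -> fourier f m = 0.
  elim: n m => [|n IHn] m mn; first exact: af.
  have [->|m_neq] := eqVneq m n%:Z; last first.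
    by apply: IHn; rewrite lt_neqAle m_neq /= -ltzD1 addrC -intS.
  have fourier_shift j : fourier (fun t => f t * cexp (- n%:Z) t) j = fourier f (j + n%:Z).
    by rewrite fourierM_cexp opprK.
  rewrite -[n%:Z]add0r -fourier_shift; apply: (peak_weight_fourier0_eq0 wpeak).
  - exact: cintegrableM_cexp.
  - by move=> j j0; rewrite fourier_shift IHn// gtrDr.
  - by have := cintegrableM_cexp (- n%:Z) wfL1; under eq_fun do rewrite -mulrA.
by apply: fourier_eq0_ae => // -[n|n]; [apply: (f_lt n.+1); rewrite ltz_nat|exact: af].
Qed.

Lemma exists_localized_multiplier (t0 r delta eta : R) : r <= t0 -> t0 + r <= 2 * pi ->
  0 < delta -> delta * 2 <= r -> 0 < eta -> exists2 g, normalized_multiplier g &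
  forall t, T t -> delta < `|t - t0| -> normc (g t) <= eta.
Proof.
move=> rt0 t0r delta0 delta_le eta0.
have cosd01 : 0 <= cos delta < 1.
  rewrite cos_ge0_pihalf/=; last lra.
  by rewrite -[ltRHS]cos0 cos_lt_near ?normr0//; lra.
have [g gmult g_le] := exists_peak_multiplier t0 cosd01 eta0.
exists g => // t; rewrite /Tdom /= in_itv/= => /andP[t_ge0 t_le] far_t0.
rewrite g_le// ltW// cos_lt_far ?(ltW delta0)// far_t0 ltr_norml /=.
by apply/andP; split; lra.
Qed.

Lemma exists_radial_majorant (t0 r : R) (M : nat -> R) : 0 < r -> (forall k, 0 <= M k) ->
  exists w, [/\ measurable_fun T w, forall t, 0 <= w t,
    forall t, r <= `|t - t0| -> w t = 0 &
    forall k t, t <> t0 -> `|t - t0| <= r / k.+2%:R -> M k <= w t].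
Proof.
move=> r0 M0; pose W (n : nat) : R := series M n.-1.
have W_nondecreasing : {homo W : m n / (m <= n)%N >-> m <= n}.
  move=> m n mn; apply: nondecreasing_series => [k _ _|]; first exact: M0.
  by rewrite -!subn1 leq_sub2r.
have W1 : W 1%N = 0 by rewrite /W /series /= big_geq.
have W0 n : 0 <= W n by rewrite -W1 (W_nondecreasing 0%N).
(* At [t0] the value is [W 0 = 0] because [r / 0 = 0]; the last clause excludes [t0]. *)
exists (fun t => W (Num.truncn (r / `|t - t0|))); split => //.
- have mdist : measurable_fun T (fun t => r / `|t - t0|).
    apply: measurable_funM => //; apply: measurable_funV_ge0 => //.
    by apply: measurableT_comp => //; exact: measurable_funB.
  have mW : measurable_fun setT (fun x : R => W (Num.truncn x)).
    apply: nondecreasing_measurable => // x y xy.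
    by apply: W_nondecreasing; exact: le_truncn.
  exact: (measurableT_comp mW mdist).
- move=> t rt; apply/eqP; rewrite eq_le W0 andbT -W1 W_nondecreasing// truncn_le_nat.
  rewrite (le_lt_trans (_ : _ <= 1)) ?ltr1n//.
  by rewrite ler_pdivrMr ?mul1r// (lt_le_trans r0).
- move=> k t tt0 near_t0; apply: le_trans (_ : W k.+2 <= _).
    have -> : W k.+2 = W k.+1 + M k by rewrite /W seriesSr.
    by rewrite lerDr.
  have d0 : 0 < `|t - t0| by rewrite normr_gt0 subr_eq0; exact/eqP.
  by rewrite W_nondecreasing// truncn_gt_nat ler_pdivlMr// mulrC -ler_pdivlMr.
Qed.

Lemma exists_peak_weight (t0 r : R) : 0 < r -> r <= t0 -> t0 + r <= 2 * pi ->
  exists2 w, measurable_fun T w /\ peak_weight t0 w & forall t, r <= `|t - t0| -> w t = 0.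
Proof.
move=> r0 rt0 t0r; pose delta (k : nat) : R := r / k.+2%:R.
have /choice[g gP] k : exists g : R -> C, normalized_multiplier g /\
    forall t, T t -> delta k < `|t - t0| -> normc (g t) <= k.+1%:R^-1.
  have delta0 : 0 < delta k by rewrite divr_gt0.
  have delta_le : delta k * 2 <= r.
    by rewrite /delta mulrAC ler_pdivrMr// ler_pM2l// ler_nat.
  have k0 : 0 < k.+1%:R^-1 :> R by rewrite invr_gt0.
  by have [g ? ?] := exists_localized_multiplier rt0 t0r delta0 delta_le k0; exists g.
have /choice[M MP] k : exists M, forall t, normc (g k t) <= M by case: (gP k) => -[].
have M0 k : 0 <= k.+1%:R * M k by rewrite mulr_ge0// (le_trans _ (MP k 0)) ?normc_ge0.
have [w [mw w0 w_far w_near]] := exists_radial_majorant t0 r0 M0.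
exists w => //; split => // k; exists (g k) => [|t Tt tt0]; first by case: (gP k).
have [near_t0|far_t0] := leP `|t - t0| (delta k).
  apply: le_trans (_ : k.+1%:R * M k <= _); first by rewrite ler_wpM2l.
  by rewrite -[leLHS]add0r lerD ?w_near.
apply: le_trans (_ : 1 <= _); last by rewrite lerDl.
by rewrite mulrC -ler_pdivlMr// mul1r (gP k).2.
Qed.

(* The weights live on disjoint arcs of radius pi / (|I| + 1). *)
Lemma exists_disjoint_annihilating_weights (I : finType) : exists2 w : I -> R -> R,
  forall i, annihilating_weight (w i) & disjoint_supports w.
Proof.
pose r : R := pi / #|I|.+1%:R.
have r0 : 0 < r by rewrite divr_gt0// pi_gt0.
pose t0 (i : I) : R := (2 * (enum_rank i)%:R + 1) * r.
have /choice[w wP] i : exists w, [/\ measurable_fun T w, peak_weight (t0 i) w &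
    forall t, r <= `|t - t0 i| -> w t = 0].
  have [||w [mw wpeak] w0] := @exists_peak_weight (t0 i) r r0; last by exists w.
    by rewrite /t0 ler_peMl ?(ltW r0)// lerDr mulr_ge0.
  have -> : t0 i + r = 2 * ((enum_rank i).+1%:R * r) by rewrite /t0 -natr1; ring.
  rewrite ler_pM2l// /r mulrA ler_pdivrMr// mulrC ler_pM2l ?pi_gt0// ler_nat ltnS.
  exact: ltnW.
exists w => [i|i j t].
  by have [mw wpeak _] := wP i; exact: peak_weight_annihilating wpeak.
wlog rank_ij : i j / (enum_rank i < enum_rank j)%N => [wlog_ij ij|_].
  have : enum_rank i != enum_rank j :> nat by rewrite (inj_eq val_inj) (inj_eq enum_rank_inj).
  rewrite neq_ltn => /orP[/wlog_ij|/wlog_ij wji]; first exact.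
  by have [|->|->] := wji; [rewrite eq_sym|right|left].
have [_ _ wi0] := wP i; have [_ _ wj0] := wP j.
have [/wi0|near_i] := leP r `|t - t0 i|; first by left.
have [/wj0|near_j] := leP r `|t - t0 j|; first by right.
have : (enum_rank i).+1%:R <= (enum_rank j)%:R :> R by rewrite ler_nat.
move: near_i near_j; rewrite /t0 !ltr_norml -natr1 => /andP[_ near_i] /andP[near_j _].
by nra.
Qed.

End AnnihilatingWeights.

Lemma normc_disjoint_term_le (R : rcfType) (I : finType) (w : I -> R) (F : I -> R[i]) i :
  (forall j k, j != k -> w j = 0 \/ w k = 0) ->
  normc ((w i)%:C * F i) <= normc (\sum_j (w j)%:C * F j).
Proof.
move=> disj; have [wi0|wi_neq0] := eqVneq (w i) 0.
  by rewrite wi0 mul0r normc0 normc_ge0.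
rewrite (bigD1 i)//= [X in _ + X]big1 ?addr0// => j ji.
have [->|wi0] := disj j i ji; first by rewrite mul0r.
by rewrite wi0 eqxx in wi_neq0.
Qed.

Section Symbol.
Variables (R : realType) (n : nat) (Theta : 'cV[R -> R[i]]_n).
Local Notation C := R[i].
Local Notation mu := (@lebesgue_measure R).
Local Notation T := (@Tdom R).
Implicit Types (f : 'cV[R -> C]_n) (w : 'I_n * 'I_n -> R -> R).

Definition adjoint_mul f (t : R) : C := \sum_i (Theta i ord0 t)^* * f i ord0 t.

(* [a] is the index pair of a 2x2 minor of [Theta | f]; these minors vanish exactly
   when f is pointwise proportional to Theta. *)
Definition minor f (a : 'I_n * 'I_n) (t : R) : C :=
  Theta a.1 ord0 t * f a.2 ord0 t - Theta a.2 ord0 t * f a.1 ord0 t.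

Definition symbol w : 'rV[R -> C]_n :=
  \row_i (fun t => (Theta i ord0 t)^* + \sum_a (w a t)%:C *
    ((i == a.2)%:R * Theta a.1 ord0 t - (i == a.1)%:R * Theta a.2 ord0 t)).

Definition symbol_mul w f (t : R) : C := \sum_i symbol w ord0 i t * f i ord0 t.

Lemma symbol_mulE w f t :
  symbol_mul w f t = adjoint_mul f t + \sum_a (w a t)%:C * minor f a t.
Proof.
have sum_delta (x : C) (j : 'I_n) :
    \sum_i (i == j)%:R * x * f i ord0 t = x * f j ord0 t.
  rewrite (bigD1 j)//= eqxx mul1r big1 ?addr0// => i /negPf ->.
  by rewrite !mul0r.
rewrite /symbol_mul; under eq_bigr do rewrite mxE mulrDl mulr_suml.
rewrite big_split /=; congr (_ + _); rewrite exchange_big /=.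
apply: eq_bigr => a _; under eq_bigr do rewrite -mulrA mulrBl.
by rewrite -mulr_sumr sumrB !sum_delta.
Qed.

Lemma symbol_mul_proportional w f t (g : C) :
  \sum_i Theta i ord0 t * (Theta i ord0 t)^* = 1 ->
  (forall i, f i ord0 t = Theta i ord0 t * g) -> symbol_mul w f t = g.
Proof.
move=> Theta1 fg; rewrite symbol_mulE [X in _ + X]big1 ?addr0; last first.
  by move=> a _; rewrite /minor !fg; ring.
rewrite -[RHS]mul1r -Theta1 mulr_suml; apply: eq_bigr => i _; rewrite fg; ring.
Qed.

Lemma minor_eq0_proportional f t :
  \sum_i Theta i ord0 t * (Theta i ord0 t)^* = 1 ->
  (forall a, minor f a t = 0) -> forall i, f i ord0 t = Theta i ord0 t * adjoint_mul f t.
Proof.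
move=> Theta1 minor0 i; rewrite -[LHS]mul1r -Theta1 mulr_suml mulr_sumr.
apply: eq_bigr => l _; have /eqP := minor0 (l, i).
rewrite /minor subr_eq0 /= => /eqP kf.
by rewrite mulrAC kf; ring.
Qed.

Hypothesis Theta_inner : inner_col Theta.

Lemma inner_col_inLinf i : inLinf (Theta i ord0).
Proof. by case: Theta_inner => /(_ i)[]. Qed.

Lemma inner_col_cmeasurable i : cmeasurable (Theta i ord0).
Proof. by case: (inner_col_inLinf i). Qed.

Lemma inner_col_mul_conjc :
  {ae mu, forall t, T t -> \sum_i Theta i ord0 t * (Theta i ord0 t)^* = 1}.
Proof.
case: Theta_inner => _; apply: filterS => t norm1 Tt.
by under eq_bigr do rewrite mulc_conjc; rewrite -rmorph_sum norm1 ?rmorph1.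
Qed.

Lemma meas_row_symbol w : (forall a, measurable_fun T (w a)) -> meas_row (symbol w).
Proof.
move=> mw i; rewrite mxE; have mk := inner_col_cmeasurable.
apply: cmeasurableD; first exact: cmeasurable_conjc.
apply: cmeasurable_sum => a; apply: cmeasurableM; first exact: cmeasurable_real.
by apply: cmeasurableB; exact: cmeasurableMl.
Qed.

Lemma cmeasurable_symbol_mul w f : H2vec f -> (forall a, measurable_fun T (w a)) ->
  cmeasurable (symbol_mul w f).
Proof.
move=> f_H2 mw; apply: cmeasurable_sum => i; apply: cmeasurableM; first exact: meas_row_symbol.
by case: (f_H2 i) => -[].
Qed.

Lemma adjoint_mul_inL2 f : H2vec f -> inL 2 (adjoint_mul f).
Proof.
move=> f_H2; apply: inL2_sum => i; apply: inL2Ml; last by case: (f_H2 i).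
exact/inLinf_conjc/inner_col_inLinf.
Qed.

Lemma inner_colM_inL2 f i j : H2vec f -> inL 2 (fun t => Theta i ord0 t * f j ord0 t).
Proof. by move=> f_H2; apply: inL2Ml (inner_col_inLinf i) _; case: (f_H2 j). Qed.

Lemma minor_inL2 f a : H2vec f -> inL 2 (minor f a).
Proof. by move=> f_H2; apply: inL2B; exact: inner_colM_inL2. Qed.

Lemma minor_analytic f a : H2vec f -> analytic_coeffs (minor f a).
Proof.
move=> f_H2; have analytic_kf i j : analytic_coeffs (fun t => Theta i ord0 t * f j ord0 t).
  have [fL2 af] := f_H2 j; have [/(_ i)[kLinf ak] _] := Theta_inner.
  by apply: analytic_coeffsM => //; exact: inLinf_inL2.
by apply: analytic_coeffsB => //; exact/inL2_cintegrable/inner_colM_inL2.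
Qed.

Lemma integrable_symbol_minor_eq0 w f : H2vec f -> (forall a, annihilating_weight (w a)) ->
  disjoint_supports w -> cintegrable (symbol_mul w f) ->
  {ae mu, forall t, T t -> forall a, minor f a t = 0}.
Proof.
move=> f_H2 w_ann disj symbL1.
have diffL1 := cintegrableB symbL1 (inL2_cintegrable (adjoint_mul_inL2 f_H2)).
have wminorL1 a : cintegrable (fun t => (w a t)%:C * minor f a t).
  apply: (cintegrable_dominated _ (integrable_normc diffL1)).
    apply: cmeasurableM; first by apply: cmeasurable_real; case: (w_ann a).
    by case: (minor_inL2 a f_H2).
  move=> t _; rewrite symbol_mulE addrAC subrr add0r.
  by apply: (normc_disjoint_term_le (w := w^~ t)) => b c; exact: disj.
have minor0 : {ae mu, forall t, forall a, T t -> minor f a t = 0}.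
  apply: filter_forall => a; have [_ ann] := w_ann a.
  exact: ann (minor_inL2 a f_H2) (minor_analytic a f_H2) (wminorL1 a).
by apply: filterS minor0 => t minor0 Tt a; exact: minor0.
Qed.

Lemma in_ThetaH2_kerHankel w f : (forall a, measurable_fun T (w a)) ->
  in_ThetaH2 Theta f -> in_kerHankel (symbol w) f.
Proof.
move=> mw [fH2 [g [[gL2 ag] fg]]]; split => //.
have msymb := cmeasurable_symbol_mul fH2 mw.
have symb_g : {ae mu, forall t, T t -> symbol_mul w f t = g t}.
  apply: filterS2 inner_col_mul_conjc fg => t Theta1 fg Tt.
  by apply: symbol_mul_proportional; [exact: Theta1|exact: fg].
have gL1 := inL2_cintegrable gL2; have mg := cintegrable_cmeasurable gL1.
split; first exact/inL1P/(ae_eq_cintegrable msymb gL1 symb_g).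
by rewrite /analytic_coeffs (ae_eq_fourier msymb mg symb_g).
Qed.

Lemma kerHankel_in_ThetaH2 w f : (forall a, annihilating_weight (w a)) ->
  disjoint_supports w -> in_kerHankel (symbol w) f -> in_ThetaH2 Theta f.
Proof.
move=> w_ann disj [fH2 [/inL1P symbL1 asymb]]; split => //.
have mw a : measurable_fun T (w a) by case: (w_ann a).
have minor0 := integrable_symbol_minor_eq0 fH2 w_ann disj symbL1.
have adjL2 := adjoint_mul_inL2 fH2; have msymb := cmeasurable_symbol_mul fH2 mw.
have adj_symb : {ae mu, forall t, T t -> adjoint_mul f t = symbol_mul w f t}.
  apply: filterS minor0 => t minor0 Tt; rewrite symbol_mulE big1 ?addr0// => a _.
  by rewrite minor0// mulr0.
exists (adjoint_mul f); split.
  by split => //; rewrite /analytic_coeffs (ae_eq_fourier adjL2.1 msymb adj_symb).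
apply: filterS2 inner_col_mul_conjc minor0 => t Theta1 minor0 Tt.
by apply: minor_eq0_proportional; [exact: Theta1|exact: minor0].
Qed.

End Symbol.

Theorem mainTheorem3 (R : realType) (n : nat) (Theta : 'cV[R -> R[i]]_n) :
  inner_col Theta ->
  exists Phi : 'rV[R -> R[i]]_n,
    meas_row Phi /\
    (forall f : 'cV[R -> R[i]]_n, in_ThetaH2 Theta f <-> in_kerHankel Phi f).
Proof.
move=> Theta_inner.
have [w w_ann disj] := exists_disjoint_annihilating_weights R ('I_n * 'I_n)%type.
have mw a : measurable_fun (@Tdom R) (w a) by case: (w_ann a).
exists (symbol Theta w); split; first exact: meas_row_symbol.
by move=> f; split; [exact: in_ThetaH2_kerHankel|exact: kerHankel_in_ThetaH2].
Qed.
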